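(* Let $k$ be a field of characteristic zero and let $G$ be any torsion-free abelian group. Then the monomial defect group $$\Delta_k(G)=K_k(G)^\times/(k^\times X^G)$$ is a free abelian group.
   Context: Torsion-free abelian groups are written additively. For a field $k$ and a torsion-free abelian group $G$, the group algebra $k[G]$ has the formal monomials $X^g$, $g\in G$, as a $k$-basis, with $X^gX^h=X^{g+h}$. It is an integral domain, and $K_k(G)=\operatorname{Frac} k[G]$ denotes its field of fractions. The subgroup $k^\times X^G\leq K_k(G)^\times$ is $\{cX^g : c\in k^\times,\ g\in G\}$. Free abelian groups of arbitrary (possibly infinite) rank are allowed. *)

(* Defs.v *)
From HB Require Import structures.
From mathcomp Require Import all_boot all_order all_algebra.
From mathcomp Require Import finmap.
From mathcomp.multinomials Require Import monalg.
From mathcomp Require Import boolp classical_sets.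

Set Implicit Arguments.
Unset Strict Implicit.
Unset Printing Implicit Defensive.

Import GRing.Theory.
Local Open Scope ring_scope.

HB.mixin Record Zmodule_isTorsionFree V of GRing.Zmodule V := {
  torsion_free : forall (n : nat) (x : V), (0 < n)%N -> x *+ n = 0 -> x = 0
}.

#[short(type="torsionFreeZmodType")]
HB.structure Definition TorsionFreeZmodule :=
  {V of GRing.Zmodule V & Zmodule_isTorsionFree V}.

(* [{malg int[I]}] is the group of finitely supported functions [I -> int];
   [I] may be infinite. *)
Definition free_abelian (A : zmodType) : Prop :=
  exists (I : choiceType) (f : {additive {malg int[I]} -> A}), bijective f.

(* [monalg] only multiplies [{malg k[G]}] when [G] is a monoid without
   nontrivial units, so the convolution product is defined here, on an alias. *)
Definition groupAlg (k : fieldType) (G : zmodType) : Type := {malg k[G]}.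

HB.instance Definition _ (k : fieldType) (G : zmodType) :=
  GRing.Lmodule.on (groupAlg k G).

Definition gmon (k : fieldType) (G : zmodType) (g : G) : groupAlg k G :=
  mkmalgU g 1.

Section GroupAlgebra.
Variables (k : fieldType) (G : zmodType).
Local Notation kG := (groupAlg k G).
Local Notation "c '*X' g" := (mkmalgU g c : {malg k[G]}) (at level 40).
Implicit Types (p q r : kG) (g h : G) (c d : k).

Definition gmul p q : kG :=
  \sum_(g <- msupp p) \sum_(h <- msupp q) (mcoeff g p * mcoeff h q) *X (g + h).

Lemma gmulw (A B : {fset G}) p q :
  (msupp p `<=` A)%fset -> (msupp q `<=` B)%fset ->
  gmul p q =
  \sum_(g <- A) \sum_(h <- B) (mcoeff g p * mcoeff h q) *X (g + h).
Proof.
move=> leA leB; rewrite /gmul (big_fset_incl _ leA) /=.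
  apply/eq_bigr=> g _; apply/big_fset_incl => // h _ /mcoeff_outdom ->.
  by rewrite mulr0 monalgU0.
move=> g _ /mcoeff_outdom pg.
by rewrite big1 // => h _; rewrite pg mul0r monalgU0.
Qed.

Lemma gmulUU c d g h : gmul (c *X g) (d *X h) = (c * d) *X (g + h).
Proof. by rewrite (gmulw msuppU_le msuppU_le) !big_seq_fset1 !mcoeffUU. Qed.

Lemma gmulC : commutative gmul.
Proof.
move=> p q; rewrite /gmul exchange_big /=; apply: eq_bigr => h _.
by apply: eq_bigr => g _; rewrite mulrC addrC.
Qed.

Lemma gmulDl : left_distributive gmul +%R.
Proof.
move=> p q r.
rewrite (gmulw (fsubsetUl (msupp p) (msupp q)) (fsubset_refl _)).
rewrite (gmulw (fsubsetUr (msupp p) (msupp q)) (fsubset_refl _)).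
rewrite (gmulw (msuppD_le p q) (fsubset_refl _)).
rewrite -big_split /=; apply/eq_bigr=> g _.
rewrite -big_split /=; apply/eq_bigr=> h _.
by rewrite mcoeffD mulrDl monalgUD.
Qed.

Lemma gmul0l : left_zero 0 gmul.
Proof. by move=> p; rewrite /gmul msupp0 big_seq_fset0. Qed.

Lemma gmulDr : right_distributive gmul +%R.
Proof. by move=> p q r; rewrite gmulC gmulDl !(gmulC p). Qed.

Lemma gmul0r : right_zero 0 gmul.
Proof. by move=> p; rewrite gmulC gmul0l. Qed.

Lemma gind (S : kG -> Prop) : S 0 -> (forall p q, S p -> S q -> S (p + q)) ->
  (forall c g, S (c *X g)) -> forall p, S p.
Proof. by move=> S0 SD SX p; rewrite (monalgE p); apply: (big_ind S). Qed.

Lemma gmulA : associative gmul.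
Proof.
move=> p q r.
elim/gind: p => [|p1 p2 IH1 IH2|c g]; first by rewrite !gmul0l.
  by rewrite !gmulDl IH1 IH2.
elim/gind: q => [|q1 q2 IH1 IH2|d h]; first by rewrite !(gmul0l, gmul0r).
  by rewrite gmulDl !gmulDr gmulDl IH1 IH2.
elim/gind: r => [|r1 r2 IH1 IH2|e l]; first by rewrite !gmul0r.
  by rewrite !gmulDr IH1 IH2.
by rewrite !gmulUU mulrA addrA.
Qed.

Lemma gmul1l : left_id (gmon k 0) gmul.
Proof.
elim/gind=> [|p q IHp IHq|c g]; first exact: gmul0r.
  by rewrite gmulDr IHp IHq.
by rewrite gmulUU mul1r add0r.
Qed.

Lemma gmon0_neq0 : gmon k 0 != 0 :> kG.
Proof. by rewrite monalgU_eq0 oner_eq0. Qed.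

HB.instance Definition _ := GRing.Zmodule_isComNzRing.Build kG
  gmulA gmulC gmul1l gmulDl gmon0_neq0.

Lemma gmonE g : gmon k g = 1 *X g.
Proof. by []. Qed.

Lemma scale_gmon c g : c *: gmon k g = c *X g.
Proof. by apply/malgP => h; rewrite mcoeffZ !mcoeffU mulrnAr mulr1. Qed.

Lemma gmonD g h : gmon k (g + h) = gmon k g * gmon k h.
Proof. by rewrite [RHS]gmulUU mulr1. Qed.

Lemma gscaleAl c p q : c *: (p * q) = (c *: p) * q.
Proof.
elim/gind: p => [|p1 p2 IH1 IH2|d g]; first by rewrite scaler0 !mul0r scaler0.
  by rewrite scalerDr !mulrDl scalerDr IH1 IH2.
elim/gind: q => [|q1 q2 IH1 IH2|e h]; first by rewrite !mulr0 scaler0.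
  by rewrite !mulrDr scalerDr IH1 IH2.
have scaleX a b l : a *: (b *X l : kG) = (a * b) *X l.
  by rewrite -scale_gmon scalerA scale_gmon.
by rewrite ![_ * _]gmulUU !scaleX [RHS]gmulUU mulrA.
Qed.

HB.instance Definition _ := GRing.Lmodule_isLalgebra.Build k kG gscaleAl.

Definition gunit : pred kG := [pred p | `[< exists q, q * p = 1 >]].

Definition ginv p : kG :=
  if pselect (exists q, q * p = 1) is left e then projT1 (cid e) else p.

Lemma ginvl : {in gunit, left_inverse 1 ginv *%R}.
Proof. by move=> p /asboolP e; rewrite /ginv; case: pselect => // ?; case: cid. Qed.

Lemma gunitPl p q : q * p = 1 -> gunit p.
Proof. by move=> e; apply/asboolP; exists q. Qed.

Lemma ginv_out : {in [predC gunit], ginv =1 id}.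
Proof. by move=> p /asboolP e; rewrite /ginv; case: pselect. Qed.

HB.instance Definition _ := GRing.ComNzRing_hasMulInverse.Build kG
  ginvl gunitPl ginv_out.

End GroupAlgebra.

(* A torsion-free abelian group carries a translation-invariant total order,
   given here by its cone [P] of positive elements. *)
Lemma exists_cone (G : torsionFreeZmodType) : exists P : set G,
  [/\ ~ P 0, forall x y, P x -> P y -> P (x + y)
    & forall x, x != 0 -> P x \/ P (- x)].
Proof.
pose cone (P : set G) := ~ P 0 /\ forall x y, P x -> P y -> P (x + y).
have [F Fc tot|P [[P0 PD] maxP]] := @Zorn_bigcup G cone.
  split=> [[X /Fc[X0 _] /X0 //]|x y [X FX Xx] [Y FY Yy]].
  have [XY|YX] := tot _ _ FX FY.
    by exists Y => //; apply: (Fc _ FY).2 => //; apply: XY.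
  by exists X => //; apply: (Fc _ FX).2 => //; apply: YX.
exists P; split=> // x x0.
have Pmul n y : P y -> P (y *+ n.+1).
  by move=> Py; elim: n => // n IHn; rewrite mulrS; apply: PD.
have key y : y != 0 -> ~ P y -> exists n, P (- (y *+ n.+1)).
  move=> y0 Py; apply: contrapT => noP.
  pose Q : set G := fun z => exists n,
    P (z - y *+ n) \/ ((0 < n)%N /\ z = y *+ n).
  apply: (maxP Q).
    split=> [z Pz|QP]; first by exists 0%N; left; rewrite mulr0n subr0.
    by apply: Py; apply: QP; exists 1%N; right.
  split=> [[n [|[n0 /esym yn]]]|z t [n Hn] [m Hm]].
  - case: n => [|n]; first by rewrite mulr0n subr0.
    by rewrite sub0r => Pn; apply: noP; exists n.
  - by move/eqP: y0; apply; apply: torsion_free yn.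
  exists (n + m)%N; rewrite mulrnDr.
  case: Hn Hm => [Pz|[n0 ->]] [Pt|[m0 ->]].
  - by left; rewrite opprD addrACA; apply: PD.
  - by left; rewrite opprD addrACA subrr addr0.
  - by left; rewrite opprD addrACA subrr add0r.
  - by right; rewrite addn_gt0 n0.
have [|nPx] := pselect (P x); first by left.
have [|nPNx] := pselect (P (- x)); first by right.
have [n Pn] := key _ x0 nPx.
have [|m] := key (- x) _ nPNx; first by rewrite oppr_eq0.
rewrite mulNrn opprK => Pm.
case: P0; rewrite -(subrr (x *+ (n.+1 * m.+1))) [in X in X - _]mulnC mulrnA.
by rewrite mulrnA -mulNrn; apply: PD; apply: Pmul.
Qed.

Lemma groupAlg_domain (k : fieldType) (G : torsionFreeZmodType)
    (p q : groupAlg k G) : p * q = 0 -> (p == 0) || (q == 0).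
Proof.
have [P [P0 PD Ptot]] := exists_cone G.
have top (r : groupAlg k G) : r != 0 -> exists2 m, mcoeff m r != 0
    & forall g, mcoeff g r != 0 -> g = m \/ P (m - g).
  move=> r0.
  have tops (s : seq G) : s != [::] ->
      exists2 m, m \in s & forall g, g \in s -> g = m \/ P (m - g).
    elim: s => // a [|b s] IHs _.
      by exists a; rewrite ?mem_head // => g; rewrite inE => /eqP; left.
    have [//|m ms mmax] := IHs.
    have [<-|am] := eqVneq m a.
      exists m; rewrite ?mem_head // => g.
      by rewrite inE => /orP[/eqP|/mmax //]; left.
    have [||Pam] := Ptot (m - a); first by rewrite subr_eq0.
      move=> Pma; exists m; first by rewrite inE ms orbT.
      by move=> g; rewrite inE => /orP[/eqP ->|/mmax //]; right.
    rewrite opprB in Pam.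
    exists a; first exact: mem_head.
    move=> g; rewrite inE => /orP[/eqP|/mmax [->|Pmg]]; [by left|by right|].
    by right; rewrite -(subrK m a) -addrA; apply: PD.
  have [|m ms mmax] := tops (msupp r).
    apply: contra_neq r0 => r0; rewrite (monalgE r) big_seq_cond big_pred0 //.
    by move=> g; rewrite r0.
  by exists m => [|g]; rewrite mcoeff_neq0 //; apply: mmax.
move=> pq0; apply/norP => -[/top[m pm mmax] /top[n qn nmax]].
have /(congr1 (mcoeff (m + n))) := pq0.
rewrite [_ * _]/(gmul p q) /gmul mcoeff0 raddf_sum /=.
rewrite (big_fsetD1 m) -?mcoeff_neq0 //= raddf_sum /=.
rewrite (big_fsetD1 n) -?mcoeff_neq0 //= mcoeffUU.
have sep g h : mcoeff g p != 0 -> mcoeff h q != 0 ->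
    g + h = m + n -> g = m /\ h = n.
  move=> /mmax[->|Pg] /nmax[->|Ph] //.
  - by move/addrI.
  - by move/addIr.
  move=> e; case: P0; rewrite -(subrr (m + n)) -{2}e opprD addrACA.
  exact: PD.
rewrite big1_fset => [|h + _]; last first.
  rewrite in_fsetD1 -mcoeff_neq0 => /andP[hn qh]; rewrite mcoeffU.
  by case: eqP => // /(sep _ _ pm qh)[_ /eqP]; rewrite (negPf hn).
rewrite big1_fset => [|g + _]; last first.
  rewrite in_fsetD1 -mcoeff_neq0 => /andP[gm pg].
  rewrite raddf_sum /= big1_fset // => h; rewrite -mcoeff_neq0 => qh _.
  rewrite mcoeffU.
  by case: eqP => // /(sep _ _ pg qh)[/eqP]; rewrite (negPf gm).
by rewrite !addr0 => /eqP; rewrite mulf_eq0 (negPf pm) (negPf qn).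
Qed.

HB.instance Definition _ (k : fieldType) (G : torsionFreeZmodType) :=
  GRing.ComUnitRing_isIntegral.Build (groupAlg k G) (@groupAlg_domain k G).

Definition groupFrac (k : fieldType) (G : torsionFreeZmodType) : fieldType :=
  {fraction (groupAlg k G)}.

(* The multiplicative group of a field, as a [zmodType]: the group law is
   denoted [+] but is the multiplication of [K]. *)
Record fieldUnits (K : fieldType) := FieldUnits {
  fuval : K;
  fuval_neq0 : fuval != 0
}.

HB.instance Definition _ (K : fieldType) := [isSub for @fuval K].
HB.instance Definition _ (K : fieldType) := [Choice of fieldUnits K by <:].

Section FieldUnits.
Variable K : fieldType.
Implicit Types u v : fieldUnits K.

Definition fu1 : fieldUnits K := FieldUnits (oner_neq0 K).

Fact fuinv_proof u : (fuval u)^-1 != 0.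
Proof. by rewrite invr_eq0 fuval_neq0. Qed.
Definition fuinv u : fieldUnits K := FieldUnits (fuinv_proof u).

Fact fumul_proof u v : fuval u * fuval v != 0.
Proof. by rewrite mulf_neq0 ?fuval_neq0. Qed.
Definition fumul u v : fieldUnits K := FieldUnits (fumul_proof u v).

Lemma fumulA : associative fumul.
Proof. by move=> u v w; apply/val_inj; rewrite /= mulrA. Qed.
Lemma fumulC : commutative fumul.
Proof. by move=> u v; apply/val_inj; rewrite /= mulrC. Qed.
Lemma fumul1l : left_id fu1 fumul.
Proof. by move=> u; apply/val_inj; rewrite /= mul1r. Qed.
Lemma fumulVl : left_inverse fu1 fuinv fumul.
Proof. by move=> u; apply/val_inj; rewrite /= mulVf ?fuval_neq0. Qed.

HB.instance Definition _ := GRing.isZmodule.Build (fieldUnits K)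
  fumulA fumulC fumul1l fumulVl.
End FieldUnits.

Section MonomialDefect.
Variables (k : fieldType) (G : torsionFreeZmodType).

Definition monomial_units : {pred fieldUnits (groupFrac k G)} :=
  fun u => `[< exists (c : k) (g : G),
    c != 0 /\ fuval u = tofrac (c *: gmon k g) >].

Lemma monomial_units_closed : zmod_closed monomial_units.
Proof.
split=> [|u v /asboolP[c [g [c0 cg]]] /asboolP[d [h [d0 dh]]]].
  by apply/asboolP; exists 1, 0; rewrite oner_neq0 scale1r rmorph1.
apply/asboolP; exists (c / d), (g - h); split.
  by rewrite mulf_neq0 // invr_eq0.
rewrite [LHS]/(fuval u / fuval v); apply: (canLR (mulfK (fuval_neq0 v))).
rewrite cg dh -rmorphM; congr tofrac.
rewrite !scale_gmon [RHS]gmulUU.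
by rewrite divfK // subrK.
Qed.

HB.instance Definition _ := GRing.isZmodClosed.Build
  (fieldUnits (groupFrac k G)) monomial_units monomial_units_closed.

Definition monomial_defect : zmodType :=
  Quotient.quot (monomial_units : zmodClosed _).

End MonomialDefect.

Arguments monomial_units : clear implicits.

(* Main.v *)
From HB Require Import structures.
Require Import Defs.
From mathcomp Require Import all_boot all_order all_algebra.
From mathcomp Require Import finmap.
From mathcomp.multinomials Require Import monalg.
From mathcomp Require Import boolp classical_sets.
From mathcomp Require Import generic_quotient qpoly.

Set Implicit Arguments.
Unset Strict Implicit.
Unset Printing Implicit Defensive.

Import GRing.Theory.
Local Open Scope ring_scope.
Local Open Scope classical_set_scope.

(** For a subgroup H of G let K(H) be the fraction field of k[H] inside
    K = K(G), and let W(H) = K(H)^* X^G, a subgroup of K^*. Then W(0) is the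
    group k^* X^G of monomials and W(G) = K^*, so what is wanted is a basis of
    W(G) modulo W(0). It is found by climbing from 0 to G through pure subgroups
    H, adding at each step one element x outside H and closing up under
    division; the new quotients W(H')/W(H) turn out to be free, and bases of
    successive quotients add up to a basis of the whole. Zorn's lemma, applied
    to pairs made of a pure subgroup H and a basis of W(H) modulo W(0), takes
    the place of a transfinite enumeration ([basis_level]).

    The point of proceeding this way is that only polynomials in one variable
    over a field are met. Put F = K(H). The closure H' of H + Zx under division
    is the increasing union of the groups L_n = {y | n! y in H + Zx}, and
    since H is pure L_n = H + Z y_n for some y_n ([division_adjoin]). With
    t = X^(y_n), transcendental over F, the field K(L_n) is F(t).

    - Unique factorization in F[t] makes W(L_0)/W(H) free on the monic
      irreducible polynomials other than t ([basis_rational_constant]).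

    - Passing from L_n to L_(n+1) replaces t by a new variable s such that
      t = c s^m with c in F. A monic irreducible P(t) other than t becomes
      P(c s^m), which is squarefree because the characteristic is zero and s
      does not divide it. Hence, modulo F^* X^G, the subgroup W(L_n) sits in
      W(L_(n+1)) like the group spanned by the sums over the blocks of a
      partition of the basis, all blocks being finite and nonempty, and the
      quotient is free on the irreducibles that remain after one has been
      discarded from each block ([basis_rational_power]).

    Independence is read off, in both cases, from the valuations attached to
    irreducible polynomials, which provide dual bases
    ([dual_basis_independent]). *)

(** * Bases modulo a subgroup *)

Section BasisModulo.
Variable V : zmodType.
Implicit Types (N M P B : set V) (s : seq V) (c : V -> int).

Definition subgroup N := N 0 /\ forall x y, N x -> N y -> N (x - y).

Lemma subgroupN N x : subgroup N -> N x -> N (- x).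
Proof. by case=> N0 NB Nx; rewrite -sub0r; apply: NB. Qed.

Lemma subgroupD N x y : subgroup N -> N x -> N y -> N (x + y).
Proof.
by move=> gN Nx Ny; rewrite -[y]opprK; apply: gN.2 => //; apply: subgroupN.
Qed.

Lemma subgroupMn N x n : subgroup N -> N x -> N (x *+ n).
Proof.
move=> gN Nx; elim: n => [|n IHn]; first by rewrite mulr0n; apply: gN.1.
by rewrite mulrS; apply: subgroupD.
Qed.

Lemma subgroupMz N x (n : int) : subgroup N -> N x -> N (x *~ n).
Proof.
move=> gN Nx; case: n => n; first by rewrite -pmulrn; apply: subgroupMn.
by rewrite NegzE mulrNz; apply: subgroupN => //; apply: subgroupMn.
Qed.

Lemma subgroup_sum N s c :
  subgroup N -> (forall b, b \in s -> N b) -> N (\sum_(b <- s) b *~ c b).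
Proof.
move=> gN sN; rewrite big_seq; elim/big_ind: _ => [|x y|b /sN Nb].
- exact: gN.1.
- exact: subgroupD.
- exact: subgroupMz.
Qed.

Definition independent_mod N B := forall s c, uniq s ->
  (forall b, b \in s -> B b) -> N (\sum_(b <- s) b *~ c b) ->
  forall b, b \in s -> c b = 0.

(** Generation is stated through all subgroups containing N and B, so that
    spanning arguments become closure arguments and no linear combination has
    to be written down. *)
Definition generated_mod N B M :=
  forall P, subgroup P -> N `<=` P -> B `<=` P -> M `<=` P.

Definition basis_mod N M B :=
  [/\ B `<=` M, independent_mod N B & generated_mod N B M].

Lemma basis_mod0 N : basis_mod N N set0.
Proof.
split=> [b //|s c _ s0 _ b /s0 //|P _ //].
Qed.

(** A combination of B and C lying in N1 also lies in N2, which kills the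
    coefficients on C; what is left is a combination of B alone. *)
Lemma basis_mod_trans N1 N2 N3 B C : subgroup N1 -> subgroup N2 ->
  N1 `<=` N2 -> N2 `<=` N3 ->
  basis_mod N1 N2 B -> basis_mod N2 N3 C -> basis_mod N1 N3 (B `|` C).
Proof.
move=> gN1 gN2 N12 N23 [BN2 iB gB] [CN3 iC gC]; split.
- by move=> b [/BN2/N23|/CN3].
- move=> s c us sBC; rewrite (bigID (fun b => `[< B b >])) /= -big_filter
    -[X in _ + X]big_filter.
  set sB := filter _ s; set sC := filter _ s => Nsum.
  have sumB : N2 (\sum_(b <- sB) b *~ c b).
    apply: subgroup_sum => // b; rewrite mem_filter => /andP[/asboolP Bb _].
    exact: BN2.
  have c0 b : b \in sC -> c b = 0.
    apply: iC; first exact: filter_uniq.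
      by move=> d; rewrite mem_filter => /andP[/asboolP nB /sBC[]].
    rewrite -(addKr (\sum_(b <- sB) b *~ c b) (\sum_(b <- sC) _)).
    by apply: subgroupD => //; [apply: subgroupN|apply: N12].
  have sumC : \sum_(b <- sC) b *~ c b = 0.
    by rewrite big_seq big1 // => b /c0 ->; rewrite mulr0z.
  rewrite sumC addr0 in Nsum.
  move=> b bs; have [Bb|nBb] := pselect (B b).
    apply: (iB sB) => //; first exact: filter_uniq.
      by move=> d; rewrite mem_filter => /andP[/asboolP].
    by rewrite mem_filter bs andbT; apply/asboolP.
  by apply: c0; rewrite mem_filter bs andbT; apply/asboolP.
- move=> P gP N1P BCP; apply: gC => //; last by move=> b Cb; apply: BCP; right.
  by apply: gB => // b Bb; apply: BCP; left.
Qed.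

(** A linear relation involves finitely many elements, hence already holds
    inside a single member of the chain. *)
Lemma basis_mod_chain (I : Type) (J : set I) (N M : set V) (F B : I -> set V) :
  (forall i j, J i -> J j -> B i `<=` B j \/ B j `<=` B i) ->
  (forall i, J i -> basis_mod N (F i) (B i)) ->
  (forall i, J i -> F i `<=` M) ->
  M `<=` \bigcup_(i in J) F i ->
  basis_mod N M (\bigcup_(i in J) B i).
Proof.
move=> chain bas FM MF; split.
- move=> b [i Ji Bb]; apply: (FM i) => //.
  by have [BF _ _] := bas i Ji; apply: BF.
- move=> s c us sB Nsum b bs.
  have [i Ji siB] : exists2 i, J i & forall b, b \in s -> B i b.
    case: s {us Nsum} bs sB => // a s _.
    elim: s => [|d s IHs] sB.
      have [i Ji Ba] := sB a (mem_head _ _); exists i => // e.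
      by rewrite inE => /eqP ->.
    have [|i Ji iB] := IHs.
      move=> e; rewrite inE => /orP[/eqP->|es]; apply: sB.
        by rewrite mem_head.
      by rewrite !inE es !orbT.
    have [|j Jj jd] := sB d; first by rewrite !inE eqxx orbT.
    have [ij|ji] := chain i j Ji Jj.
      exists j => // e; rewrite !inE => /or3P[/eqP->|/eqP->//|es]; apply: ij.
        by apply: iB; rewrite mem_head.
      by apply: iB; rewrite inE es orbT.
    exists i => // e; rewrite !inE => /or3P[/eqP->|/eqP->|es].
    + by apply: iB; rewrite mem_head.
    + exact: ji.
    + by apply: iB; rewrite inE es orbT.
  by have [_ iBi _] := bas i Ji; apply: (iBi s c).
- move=> P gP NP BP u /MF[i Ji].
  by have [_ _ gB] := bas i Ji; apply: gB => // b Bb; apply: BP; exists i.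
Qed.

Lemma basis_mod_nat (M : nat -> set V) :
  (forall n, subgroup (M n)) -> (forall n, M n `<=` M n.+1) ->
  (forall n, exists B, basis_mod (M n) (M n.+1) B) ->
  exists B, basis_mod (M 0%N) (\bigcup_n M n) B.
Proof.
move=> gM incM /choice[B bas].
pose C n := \bigcup_(i in [set i | (i < n)%N]) B i.
have incC i j : (i <= j)%N -> C i `<=` C j.
  by move=> ij b [l li Bb]; exists l => //; apply: leq_trans li ij.
have inc0 n : M 0%N `<=` M n.
  by elim: n => // n IHn; apply: subset_trans (incM n).
exists (\bigcup_(n in setT) C n); apply: basis_mod_chain => [i j _ _|n _|n _|u].
- by case/orP: (leq_total i j) => /incC; [left|right].
- elim: n => [|n IHn].
    rewrite (_ : C 0%N = set0) ?bigcup0 //; first exact: basis_mod0.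
    by apply/seteqP; split=> // b [].
  rewrite (_ : C n.+1 = C n `|` B n).
    by apply: basis_mod_trans IHn (bas n).
  apply/seteqP; split=> b.
    case=> i /=; rewrite ltnS leq_eqVlt => /orP[/eqP->|lt_in] Bb.
      by right.
    by left; exists i.
  by case=> [[i /= lt_in]|] Bb; [exists i => //=; apply: ltnW|exists n => /=].
- by move=> u Mu; exists n.
- by case=> n _ Mu; exists n.
Qed.

(** The functionals [v b] only have to be additive on the subgroup M: the
    valuations to which this is applied are meaningful on M alone. *)
Lemma dual_basis_independent N M B (v : V -> V -> int) :
  subgroup M -> B `<=` M ->
  (forall b, B b -> forall x y, M x -> M y -> v b (x + y) = v b x + v b y) ->
  (forall b x, B b -> N x -> v b x = 0) ->
  (forall b, B b -> v b b = 1) ->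
  (forall b b', B b -> B b' -> b != b' -> v b b' = 0) ->
  independent_mod N B.
Proof.
move=> gM BM vD vN v1 v0 s c us sB Nsum b bs.
have Bb := sB _ bs.
have vb0 : v b 0 = 0.
  by apply: (addrI (v b 0)); rewrite -vD ?addr0 //; apply: gM.1.
have vbN x : M x -> v b (- x) = - v b x.
  move=> Mx; apply/eqP; rewrite -addr_eq0 -vD ?addNr ?vb0 //.
  exact: subgroupN.
have vbn x n : M x -> v b (x *+ n) = v b x *+ n.
  move=> Mx; elim: n => [|n IHn]; first by rewrite !mulr0n.
  by rewrite !mulrS vD ?IHn //; apply: subgroupMn.
have vbz x (n : int) : M x -> v b (x *~ n) = v b x *~ n.
  move=> Mx; case: n => n; first by rewrite -!pmulrn vbn.
  by rewrite NegzE !mulrNz vbN ?vbn //; apply: subgroupMn.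
have : v b (\sum_(b <- s) b *~ c b) = \sum_(d <- s) v b d *~ c d.
  elim: s {us Nsum bs} sB => [|d s IHs] sB; first by rewrite !big_nil.
  have sBs e : e \in s -> B e by move=> es; apply: sB; rewrite inE es orbT.
  have Md : M d by apply/BM/sB; rewrite mem_head.
  rewrite !big_cons vD ?IHs ?vbz //; first exact: subgroupMz.
  by apply: subgroup_sum => // e /sBs/BM.
rewrite vN // (bigD1_seq b) //= v1 // big_seq_cond big1 => [|d /andP[ds db]].
  by rewrite addr0 intz.
by rewrite v0 ?mul0rz 1?eq_sym //; apply: sB.
Qed.

End BasisModulo.

(** * Multiplicity of an irreducible polynomial *)

Section Multiplicity.
Variable F : fieldType.
Implicit Types p q r s d P : {poly F}.

Lemma irreducible_factor p : (1 < size p)%N ->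
  exists d, [/\ d \is monic, irreducible_poly d & d %| p].
Proof.
move=> p1.
pose Q n := `[< exists d, [/\ (1 < size d)%N, d %| p & size d = n] >].
have exQ : exists n, Q n by exists (size p); apply/asboolP; exists p.
have [n /asboolP[d [d1 dp <-]] min_d] := ex_minnP exQ.
have d0 : d != 0 by rewrite -size_poly_gt0 ltnW.
have lc0 : (lead_coef d)^-1 != 0 by rewrite invr_eq0 lead_coef_eq0.
exists ((lead_coef d)^-1 *: d); split.
- by rewrite monicE lead_coefZ mulVf // lead_coef_eq0.
- split; first by rewrite size_scale.
  move=> q q1 qd; have {}qd : q %| d by rewrite -(dvdpZr _ _ lc0).
  apply: (@eqp_trans _ d); last by rewrite eqp_sym eqp_scale.
  rewrite -dvdp_size_eqp // eqn_leq dvdp_leq //= min_d //; apply/asboolP.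
  exists q; split; [|exact: dvdp_trans qd dp|by []].
  rewrite ltn_neqAle eq_sym q1 size_poly_gt0.
  by apply: contraNneq d0 => q0; rewrite q0 dvd0p in qd.
- by rewrite dvdpZl.
Qed.

Lemma factor_ind (S : {poly F} -> Prop) s :
  (forall p q, S p -> S q -> S (p * q)) -> (forall c, c != 0 -> S c%:P) ->
  (forall d, d \is monic -> irreducible_poly d -> d %| s -> S d) ->
  s != 0 -> S s.
Proof.
move=> SM SC; have [n le_n] := ubnP (size s).
elim: n s le_n => // n IHn s le_n Sd s0.
have [s1|s1] := leqP (size s) 1.
  by rewrite (size1_polyC s1) in s0 *; apply: SC; rewrite -polyC_eq0.
have [d [dm irr_d /dvdpP[t st]]] := irreducible_factor s1.
have t0 : t != 0 by apply: contraNneq s0 => t0; rewrite st t0 mul0r.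
rewrite st in le_n Sd s0 *; apply: SM; last by apply: Sd; rewrite ?dvdp_mull.
apply: IHn => // [|e em irr_e et]; last by apply: Sd => //; apply: dvdp_mulr.
rewrite size_Mmonic // in le_n.
case: irr_d => d1 _; case: (size d) d1 le_n => [|[|l]] // _.
by rewrite !addnS /= ltnS => /(leq_ltn_trans (leq_addr _ _)).
Qed.

Section Irreducible.
Variable q : {poly F}.
Hypothesis irr_q : irreducible_poly q.

Lemma irreducible_dvdM p r : (q %| p * r) = (q %| p) || (q %| r).
Proof.
apply/idP/orP => [|[qp|qr]]; [|exact: dvdp_mulr|exact: dvdp_mull].
have [qp|nqp] := boolP (q %| p); first by left.
by rewrite Gauss_dvdpr ?irreducible_poly_coprime //; right.
Qed.

Lemma irreducible_dvdX p n : q %| p ^+ n -> q %| p.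
Proof.
elim: n => [|n IHn]; last by rewrite exprS irreducible_dvdM => /orP[].
by rewrite expr0 dvdp1 => /eqP q1; case: irr_q; rewrite q1.
Qed.

Lemma irreducible_ndvdC c : c != 0 -> ~~ (q %| c%:P).
Proof.
move=> c0; apply/negP => /dvdp_leq; rewrite polyC_eq0 size_polyC c0.
by case: irr_q => q1 _ /(_ isT); rewrite leqNgt q1.
Qed.

(** The bound on n loses nothing: q is not constant, so for p nonzero every n
    with q ^ n dividing p is below [size p]. *)
Definition mult p : nat := \max_(n < size p | q ^+ n %| p) n.

Lemma multE n s : ~~ (q %| s) -> mult (q ^+ n * s) = n.
Proof.
move=> qs; have s0 : s != 0 by apply: contraNneq qs => ->; rewrite dvdp0.
have q0 := irredp_neq0 irr_q.
have dvdn m : (q ^+ m %| q ^+ n * s) = (m <= n)%N.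
  have [mn|nm] := leqP m n; first by rewrite dvdp_mulr // dvdp_exp2l.
  apply/negbTE; rewrite -(subnKC nm) addSnnS exprD dvdp_mul2l ?expf_neq0 //.
  by apply: contra qs; apply: dvdp_trans; rewrite exprS dvdp_mulr.
have n_lt : (n < size (q ^+ n * s)%R)%N.
  have qn0 := expf_neq0 n q0.
  have le_n : (n <= (size (q ^+ n)%R).-1)%N.
    by rewrite size_exp leq_pmull //; case: irr_q; case: (size q) => [|[]].
  rewrite size_mul //; have := size_poly_gt0 s; rewrite s0.
  have := size_poly_gt0 (q ^+ n); rewrite qn0.
  case: (size s) (size (q ^+ n)) le_n => // k [] //= l le_n _ _.
  by rewrite addnS ltnS (leq_trans le_n) // leq_addr.
apply/eqP; rewrite eqn_leq; apply/andP; split.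
  by apply/bigmax_leqP => i; rewrite dvdn.
by apply: (@bigmax_sup _ (Ordinal n_lt)); rewrite ?dvdn.
Qed.

Lemma multP p : p != 0 -> exists n s, p = q ^+ n * s /\ ~~ (q %| s).
Proof.
have [m le_m] := ubnP (size p); elim: m p le_m => // m IHm p le_m p0.
have [qp|qp] := boolP (q %| p); last by exists 0%N, p; rewrite mul1r.
have pE := divpK qp.
have t0 : p %/ q != 0 by apply: contraNneq p0 => t0; rewrite -pE t0 mul0r.
have q0 := irredp_neq0 irr_q.
have [|//|n [s [tE qs]]] := IHm (p %/ q).
  rewrite size_divp //; case: irr_q; case: (size q) => [|[|k]] // _ _ /=.
  have := size_poly_gt0 p; rewrite p0 ltnS in le_m * => p_gt0.
  by rewrite (leq_trans _ le_m) // ltn_subrL p_gt0.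
by exists n.+1, s; split=> //; rewrite -pE tE exprSr mulrAC.
Qed.

Lemma multM p r : p != 0 -> r != 0 -> mult (p * r) = (mult p + mult r)%N.
Proof.
move=> /multP[n [s [-> qs]]] /multP[m [t [-> qt]]].
by rewrite mulrACA -exprD !multE // irreducible_dvdM negb_or qs.
Qed.

Lemma mult_ndvd p : ~~ (q %| p) -> mult p = 0%N.
Proof. by move=> qp; rewrite -[p]mul1r -(expr0 q) multE. Qed.

Lemma mult_id : mult q = 1%N.
Proof.
rewrite -[RHS](@multE 1 1%:P) ?irreducible_ndvdC ?oner_eq0 //.
by rewrite expr1 mulr1.
Qed.

End Irreducible.

Lemma mult_distinct q d : irreducible_poly q -> irreducible_poly d ->
  q \is monic -> d \is monic -> q != d -> mult q d = 0%N.
Proof.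
move=> irr_q irr_d qm dm qd; apply: mult_ndvd => //; apply: contra qd => qd.
rewrite -eqp_monic //; apply: irr_d.2 => //.
by case: irr_q => q1 _; rewrite neq_ltn q1 orbT.
Qed.

(** With n = deg q, the n + 1 powers 1, phi, ..., phi ^ n are linearly dependent
    modulo q. *)
Lemma annihilating_poly q phi : q != 0 ->
  exists2 r, r != 0 & q %| r \Po phi.
Proof.
move=> q0; pose n := (size q).-1.
pose A : 'M[F]_(n.+1, n) := \matrix_i poly_rV (phi ^+ i %% q).
have ker0 : kermx A != 0.
  rewrite -mxrank_eq0 mxrank_ker subn_eq0 -ltnNge.
  by rewrite ltnS rank_leq_col.
have /rowV0Pn[u /sub_kermxP uA u0] := ker0.
exists (rVpoly u).
  by apply: contra_neq u0 => r0; rewrite -[u]rVpolyK r0 linear0.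
have n_gt0 (i : 'I_n.+1) : (size (phi ^+ i %% q)%R <= n)%N.
  by have := ltn_modp (phi ^+ i) q; rewrite q0 (polySpred q0) ltnS.
rewrite {1}[u]row_sum_delta !linear_sum /= /dvdp.
suff -> : (\sum_i (rVpoly (u 0 i *: delta_mx 0 i) \Po phi)) %% q =
    rVpoly (u *m A).
  by rewrite uA linear0.
rewrite mulmx_sum_row linear_sum.
rewrite (big_morph _ (modpD q) (mod0p q)); apply: eq_bigr => i _.
rewrite rowK !linearZ /= rVpoly_delta comp_Xn_poly modpZl poly_rV_K //.
Qed.

(** Geometrically: the image under phi of a closed point of the affine line is a
    closed point. Some irreducible factor P of an annihilating polynomial
    works, because q is prime. *)
Lemma irreducible_below q phi : irreducible_poly q ->
  exists P, [/\ P \is monic, irreducible_poly P & q %| P \Po phi].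
Proof.
move=> irr_q; have [r r0 qr] := annihilating_poly phi (irredp_neq0 irr_q).
apply: contrapT => noP; move: qr; apply/negP.
apply: (@factor_ind (fun s => ~~ (q %| s \Po phi))) r0
  => [s t qs qt|c c0|d dm irr_d _].
- by rewrite comp_polyM irreducible_dvdM // negb_or qs.
- by rewrite comp_polyC irreducible_ndvdC.
- by apply/negP => qd; apply: noP; exists d.
Qed.

Hypothesis char0 : [pchar F]%R =i pred0.

Lemma coprime_deriv P : irreducible_poly P -> coprimep P P^`().
Proof.
move=> irr_P; have P0 := irredp_neq0 irr_P.
have P1 : (1 < size P)%N by case: irr_P.
have dP0 : P^`() != 0.
  apply: contraNneq (P0) => /polyP/(_ (size P).-2).
  rewrite -lead_coef_eq0 coef_deriv coef0 prednK; last first.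
    by case: (size P) P1 => [|[]].
  move/eqP; rewrite -mulr_natr mulf_eq0 (pcharf0P _).1 //.
  by case/orP=> //; case: (size P) P1 => [|[]].
rewrite irreducible_poly_coprime //; apply/negP => /dvdp_leq => /(_ dP0).
by rewrite leqNgt lt_size_deriv.
Qed.

Variables (c : F) (m : nat).
Hypotheses (c0 : c != 0) (m0 : (0 < m)%N).
Local Notation phi := (c *: 'X^m).

(** If q ^ 2 divided P(phi), then q would divide its derivative
    P'(phi) * phi'. But in characteristic zero P is separable, so that P'(phi)
    is coprime to P(phi), and phi' is a nonzero constant times a power of 'X. *)
Lemma mult_unramified q P : irreducible_poly q -> ~~ (q %| 'X) ->
  irreducible_poly P -> q %| P \Po phi -> mult q (P \Po phi) = 1%N.
Proof.
move=> irr_q qX irr_P qP.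
have ndvd_dP : ~~ (q %| P^`() \Po phi).
  have /(coprimep_comp_poly phi) := coprime_deriv irr_P.
  by rewrite -irreducible_poly_coprime // => /(coprimep_dvdr qP).
have [s PE] := dvdpP _ _ qP; have := deriv_comp P phi.
have qs : ~~ (q %| s).
  apply: contra ndvd_dP => qs.
  have : q %| (P^`() \Po phi) * phi^`().
    rewrite -deriv_comp PE derivM.
    by apply: dvdp_add; [apply: dvdp_mull|apply: dvdp_mulr].
  rewrite irreducible_dvdM // => /orP[//|].
  rewrite derivZ derivXn -scaler_nat scalerA dvdpZr.
    by move/irreducible_dvdX => /(_ irr_q); rewrite (negbTE qX).
  by rewrite mulf_neq0 // (pcharf0P _).1 // -lt0n.
by rewrite PE mulrC -[X in mult q (X * _)]expr1 multE.
Qed.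

Lemma mult_comp q P r : irreducible_poly q -> ~~ (q %| 'X) ->
  irreducible_poly P -> q %| P \Po phi -> r != 0 ->
  mult q (r \Po phi) = mult P r.
Proof.
move=> irr_q qX irr_P qP /(multP irr_P)[n [s [-> Ps]]].
have Pphi0 : P \Po phi != 0.
  by rewrite comp_poly_eq0 ?irredp_neq0 // size_scale // size_polyXn.
have qs : ~~ (q %| s \Po phi).
  rewrite -irreducible_poly_coprime //; apply: coprimep_dvdr qP _.
  by apply: coprimep_comp_poly; rewrite irreducible_poly_coprime.
have sphi0 : s \Po phi != 0 by apply: contraNneq qs => ->; rewrite dvdp0.
rewrite multE // comp_polyM rmorphXn /= multM ?expf_neq0 //.
rewrite [X in (_ + X)%N]mult_ndvd // addn0.
elim: n => [|n IHn].
  by rewrite expr0 mult_ndvd // irreducible_ndvdC ?oner_eq0.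
by rewrite exprS multM ?expf_neq0 // IHn mult_unramified.
Qed.

End Multiplicity.

(** * Rational functions modulo constants and monomials *)

Section FieldUnitsTheory.
Variable K : fieldType.
Implicit Types u v : fieldUnits K.

Lemma fuval0 : fuval (0 : fieldUnits K) = 1. Proof. by []. Qed.
Lemma fuvalD u v : fuval (u + v) = fuval u * fuval v. Proof. by []. Qed.
Lemma fuvalN u : fuval (- u) = (fuval u)^-1. Proof. by []. Qed.

Lemma fuval_inj : injective (@fuval K).
Proof. by move=> u v uv; apply: val_inj. Qed.

Definition to_unit (x : K) : fieldUnits K :=
  if pselect (x != 0) is left x0 then FieldUnits x0 else 0.

Lemma to_unitK x : x != 0 -> fuval (to_unit x) = x.
Proof. by rewrite /to_unit; case: pselect. Qed.

End FieldUnitsTheory.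

(** The setting: F embedded in K by iota, an element t of K transcendental over
    F, and a group E of units of K containing t, in the application all the
    monomials X^g. The groups compared are F^* E, F(t)^* E and, when
    t1 = c t^m, F(t1)^* E. *)
Section RationalFunctions.
Variables (F K : fieldType) (iota : {rmorphism F -> K}).
Variable E : set (fieldUnits K).
Hypothesis gE : subgroup E.
Implicit Types (p q r d P : {poly F}) (u e : fieldUnits K) (t : K).

Local Notation eval t p := (map_poly iota p).[t].

Definition transcendental t := forall p, eval t p = 0 -> p = 0.

(** E meets F(t)^* only in elements a t^n with a in F^*; integral exponents n are
    expressed by a pair of natural numbers. *)
Definition monomials_only t := forall e p r, E e -> r != 0 ->
  fuval e * eval t r = eval t p ->
  exists a i j, a != 0 /\ fuval e * t ^+ i = iota a * t ^+ j.

Definition fraction_of t u p r := [/\ p != 0, r != 0 &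
  exists2 e, E e & fuval u * eval t r = eval t p * fuval e].

Definition rational_units t : set (fieldUnits K) :=
  [set u | exists p r, fraction_of t u p r].

Definition constant_units : set (fieldUnits K) :=
  [set u | exists a e, [/\ a != 0, E e & fuval u = iota a * fuval e]].

Lemma rational_subgroup t : subgroup (rational_units t).
Proof.
split=> [|u v [p [r [p0 r0 [e Ee ue]]]] [p' [r' [p'0 r'0 [f Ef vf]]]]].
  exists 1, 1; split; rewrite ?oner_eq0 //; exists 0; first exact: gE.1.
  by rewrite fuval0 mulr1 mul1r.
exists (p * r'), (r * p'); split; rewrite ?mulf_neq0 //.
exists (e - f); first exact: gE.2.
rewrite !fuvalD !fuvalN !rmorphM !hornerM.
have PV : eval t p' / fuval v = eval t r' / fuval f.
  by apply/eqP; rewrite eqr_div ?fuval_neq0 // -vf mulrC.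
by rewrite mulrACA ue [_^-1 * _]mulrC PV -mulrACA.
Qed.

Lemma constant_rational t : constant_units `<=` rational_units t.
Proof.
move=> u [a [e [a0 Ee ue]]].
exists a%:P, 1; split; rewrite ?oner_eq0 ?polyC_eq0 //.
by exists e => //; rewrite rmorph1 hornerC mulr1 map_polyC hornerC.
Qed.

Section Transcendental.
Variable tau : fieldUnits K.
Local Notation t := (fuval tau).
Hypotheses (Etau : E tau) (tr_t : transcendental t) (mono_t : monomials_only t).

Lemma eval_inj p q : eval t p = eval t q -> p = q.
Proof.
move=> pq; apply/eqP; rewrite -subr_eq0; apply/eqP/tr_t.
by rewrite rmorphB hornerD hornerN pq subrr.
Qed.

Lemma eval_neq0 p : p != 0 -> eval t p != 0.
Proof. by apply: contra_neq; apply: tr_t. Qed.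

Definition poly_unit p := to_unit (eval t p).

Lemma poly_unitE p : p != 0 -> fuval (poly_unit p) = eval t p.
Proof. by move=> p0; rewrite to_unitK ?eval_neq0. Qed.

Lemma poly_unitM p q : p != 0 -> q != 0 ->
  poly_unit (p * q) = poly_unit p + poly_unit q.
Proof.
move=> p0 q0; apply: fuval_inj; rewrite fuvalD !poly_unitE ?mulf_neq0 //.
by rewrite rmorphM hornerM.
Qed.

Lemma poly_unit_inj p q : p != 0 -> q != 0 ->
  poly_unit p = poly_unit q -> p = q.
Proof.
by move=> p0 q0 /(congr1 (@fuval K)); rewrite !poly_unitE //; apply: eval_inj.
Qed.

Lemma poly_unit_fraction p : p != 0 -> fraction_of t (poly_unit p) p 1.
Proof.
move=> p0; split; rewrite ?oner_eq0 //; exists 0; first exact: gE.1.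
by rewrite poly_unitE // rmorph1 hornerC.
Qed.

Lemma poly_unitX : poly_unit 'X = tau.
Proof.
by apply: fuval_inj; rewrite poly_unitE ?polyX_eq0 // map_polyX hornerX.
Qed.

Lemma fraction_unit u p r : fraction_of t u p r ->
  exists2 e, E e & u = poly_unit p - poly_unit r + e.
Proof.
move=> [p0 r0 [e Ee ue]]; exists e => //; apply: fuval_inj.
rewrite !fuvalD fuvalN !poly_unitE // mulrAC -ue mulfK ?eval_neq0 //.
Qed.

(** The irreducible polynomial 'X is excluded since t belongs to E and so
    becomes trivial in the quotients. *)
Definition place q : Prop :=
  [/\ q \is monic, irreducible_poly q & ~~ (q %| 'X)].

Lemma place_or_X q : q \is monic -> irreducible_poly q -> place q \/ q = 'X.
Proof.
move=> qm irr_q; have [qX|qX] := boolP (q %| 'X); [right|by left].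
apply/eqP; rewrite -eqp_monic ?monicX //.
have := irredp_XsubC (0 : F); rewrite subr0 => irrX; apply: irrX => //.
by case: irr_q => q1 _; rewrite neq_ltn q1 orbT.
Qed.

Lemma place_neq0 q : place q -> q != 0.
Proof. by case=> _ /irredp_neq0. Qed.

Lemma poly_unit_generated (S : set (fieldUnits K)) s : subgroup S ->
  constant_units `<=` S -> (forall d, place d -> d %| s -> S (poly_unit d)) ->
  s != 0 -> S (poly_unit s).
Proof.
move=> gS CS Sd s0.
suff [] : s != 0 /\ S (poly_unit s) by [].
apply: (@factor_ind _ (fun s => s != 0 /\ S (poly_unit s))) s0
  => [p q [p0 Sp] [q0 Sq]|c c0|d dm irr_d ds].
- by rewrite poly_unitM ?mulf_neq0 //; split=> //; apply: subgroupD.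
- rewrite polyC_eq0; split=> //; apply: CS; exists c, 0; split=> //.
    exact: gE.1.
  by rewrite poly_unitE ?polyC_eq0 // map_polyC hornerC mulr1.
- split; first exact: irredp_neq0.
  have [pd|->] := place_or_X dm irr_d; first exact: Sd.
  rewrite poly_unitX; apply: CS; exists 1, tau; split; rewrite ?oner_eq0 //.
  by rewrite rmorph1 mul1r.
Qed.

Lemma rational_generated (S : set (fieldUnits K)) : subgroup S ->
  constant_units `<=` S -> (forall d, place d -> S (poly_unit d)) ->
  rational_units t `<=` S.
Proof.
move=> gS CS Sd u [p [r up]]; have [p0 r0 _] := up.
have [e Ee ->] := fraction_unit up.
apply: subgroupD => //; last first.
  by apply: CS; exists 1, e; split; rewrite ?oner_eq0 ?rmorph1 ?mul1r.
apply: subgroupD => //; first by apply: poly_unit_generated => // d /Sd.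
by apply: subgroupN => //; apply: poly_unit_generated => // d /Sd.
Qed.

(** Two writings of u differ by an element of E lying in F(t), that is by some
    a t^n, and q divides neither a nor 'X. *)
Lemma fraction_mult_unique q u p r p' r' : place q ->
  fraction_of t u p r -> fraction_of t u p' r' ->
  (mult q p + mult q r' = mult q p' + mult q r)%N.
Proof.
move=> [qm irr_q qX] [p0 r0 [e Ee ue]] [p'0 r'0 [f Ef uf]].
have ef : fuval (e - f) * eval t (p * r') = eval t (p' * r).
  rewrite fuvalD fuvalN !rmorphM !hornerM.
  rewrite mulrACA [fuval e * _]mulrC -ue [_^-1 * _]mulrC mulrACA uf.
  by rewrite mulrACA mulfV ?mulr1 ?fuval_neq0.
have [|a [i [j [a0 aE]]]] := mono_t (gE.2 _ _ Ee Ef) _ ef.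
  exact: mulf_neq0.
have : a%:P * 'X^j * (p * r') = 'X^i * (p' * r).
  apply: eval_inj.
  rewrite [in LHS]rmorphM [in RHS]rmorphM ![(_ * _).[_]]hornerM -ef.
  rewrite mulrA; congr (_ * _).
  rewrite /= map_polyXn hornerXn [RHS]mulrC aE rmorphM hornerM /=.
  rewrite map_polyXn hornerXn.
  by rewrite map_polyC hornerC.
have Xn0 n : 'X^n != 0 :> {poly F} by rewrite expf_neq0 ?polyX_eq0.
have multXn n : mult q 'X^n = 0%N.
  by apply: mult_ndvd => //; apply: contra qX; apply: irreducible_dvdX.
move/(congr1 (mult q)); rewrite !multM ?mulf_neq0 ?polyC_eq0 // !multXn.
by rewrite mult_ndvd ?irreducible_ndvdC // !add0n.
Qed.

(** The order at q of the F(t)-part of an element of F(t)^* E; by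
    [fraction_mult_unique] it does not depend on the chosen writing. *)
Definition valuation q u : int :=
  if pselect (exists pr, fraction_of t u pr.1 pr.2) is left h
  then (mult q (sval (cid h)).1)%:Z - (mult q (sval (cid h)).2)%:Z else 0.

Lemma valuationE q u p r : place q -> fraction_of t u p r ->
  valuation q u = (mult q p)%:Z - (mult q r)%:Z.
Proof.
move=> pq up; rewrite /valuation.
case: pselect => [h|[]]; last by exists (p, r).
case: cid => -[p' r'] /= up'; apply/eqP.
rewrite subr_eq addrAC eq_sym subr_eq -!PoszD.
by rewrite (fraction_mult_unique pq up up').
Qed.

Lemma valuationD q u v : place q -> rational_units t u -> rational_units t v ->
  valuation q (u + v) = valuation q u + valuation q v.
Proof.
move=> pq [p [r up]] [p' [r' vp]].
rewrite (valuationE pq up) (valuationE pq vp).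
have [p0 r0 [e Ee ue]] := up; have [p'0 r'0 [f Ef vf]] := vp.
have irr_q : irreducible_poly q by case: pq.
rewrite (@valuationE _ _ (p * p') (r * r')) //.
  by rewrite !multM // !PoszD opprD addrACA.
split; rewrite ?mulf_neq0 //; exists (e + f); first exact: subgroupD.
by rewrite !rmorphM !hornerM !fuvalD mulrACA ue vf mulrACA.
Qed.

Lemma valuation_poly q p : place q -> p != 0 ->
  valuation q (poly_unit p) = (mult q p)%:Z.
Proof.
move=> pq p0; rewrite (valuationE pq (poly_unit_fraction p0)).
case: pq => _ irr_q _.
rewrite [in X in _ - X]mult_ndvd ?subr0 //.
by rewrite (irreducible_ndvdC irr_q) ?oner_eq0.
Qed.

Lemma valuation_id q : place q -> valuation q (poly_unit q) = 1.
Proof.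
by move=> pq; rewrite valuation_poly ?place_neq0 // mult_id //; case: pq.
Qed.

Lemma valuation_distinct q d : place q -> place d -> q != d ->
  valuation q (poly_unit d) = 0.
Proof.
move=> pq pd qd; rewrite valuation_poly ?place_neq0 //.
by case: pq pd => qm iq _ [dm id _]; rewrite mult_distinct.
Qed.

(** The inverse of [poly_unit] on places: bases are sets of units, whereas
    the dual functionals are indexed by polynomials. *)
Definition place_of u : {poly F} :=
  if pselect (exists q, place q /\ u = poly_unit q) is left h
  then sval (cid h) else 0.

Lemma place_ofK q : place q -> place_of (poly_unit q) = q.
Proof.
move=> pq; rewrite /place_of; case: pselect => [h|[]]; last by exists q.
by case: cid => d /= [pd qd]; apply: poly_unit_inj; rewrite ?place_neq0.
Qed.

(** The dual functionals are the valuations. *)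
Lemma basis_rational_constant : basis_mod constant_units (rational_units t)
  [set u | exists q, place q /\ u = poly_unit q].
Proof.
set B := [set u | _]; have BW : B `<=` rational_units t.
  by move=> _ [q [pq ->]]; exists q, 1; apply/poly_unit_fraction/place_neq0.
split=> // [|S gS CS BS]; last first.
  by apply: rational_generated => // d pd; apply: BS; exists d.
apply: (@dual_basis_independent _ _ _ _ (fun b => valuation (place_of b))
  (rational_subgroup t)) => //.
- by move=> _ [q [pq ->]] x y; rewrite place_ofK //; apply: valuationD.
- move=> _ u [q [pq ->]] [a [e [a0 Ee ue]]]; rewrite place_ofK //.
  have irr_q : irreducible_poly q by case: pq.
  rewrite (@valuationE _ _ a%:P 1) ?mult_ndvd ?irreducible_ndvdC ?oner_eq0 //.
  split; rewrite ?oner_eq0 ?polyC_eq0 //.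
  by exists e => //; rewrite rmorph1 hornerC mulr1 map_polyC hornerC.
- by move=> _ [q [pq ->]]; rewrite place_ofK // valuation_id.
- move=> _ _ [q [pq ->]] [d [pd ->]] qd; rewrite place_ofK //.
  by rewrite valuation_distinct //; apply: contraNneq qd => ->.
Qed.

Section Ramification.
Hypothesis char0 : [pchar F]%R =i pred0.
Variables (c : F) (m : nat).
Hypotheses (c0 : c != 0) (m0 : (0 < m)%N).
Local Notation phi := (c *: 'X^m).
Local Notation t1 := (iota c * t ^+ m).

Lemma eval_comp p : eval t (p \Po phi) = eval t1 p.
Proof.
rewrite map_comp_poly horner_comp map_polyZ map_polyXn.
by rewrite hornerZ hornerXn.
Qed.

Lemma comp_phi_neq0 p : p != 0 -> p \Po phi != 0.
Proof.
by move=> p0; rewrite comp_poly_eq0 // size_scale // size_polyXn.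
Qed.

Lemma fraction_comp u p r : fraction_of t1 u p r ->
  fraction_of t u (p \Po phi) (r \Po phi).
Proof.
by move=> [p0 r0 ue]; split; rewrite ?comp_phi_neq0 // !eval_comp.
Qed.

(** The irreducible polynomial P of the variable t1 lying under q, that is, such
    that q divides P(c t^m). *)
Definition below q : {poly F} :=
  if pselect (exists P, [/\ P \is monic, irreducible_poly P & q %| P \Po phi])
    is left h then sval (cid h) else 0.

Lemma belowP q : place q ->
  [/\ below q \is monic, irreducible_poly (below q) & q %| below q \Po phi].
Proof.
case=> _ irr_q _; rewrite /below; case: pselect => [h|[]]; last first.
  exact: irreducible_below.
by case: cid.
Qed.

(** Distinct monic irreducible polynomials are coprime, and remain so after
    composition with phi. *)
Lemma below_unique q P : place q -> P \is monic -> irreducible_poly P ->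
  q %| P \Po phi -> below q = P.
Proof.
move=> pq Pm irr_P qP; have [bm irr_b qb] := belowP pq.
apply/eqP; rewrite -eqp_monic //.
have [bP|bP] := boolP (below q %| P).
  by apply: irr_P.2 => //; case: irr_b => b1 _; rewrite neq_ltn b1 orbT.
rewrite -irreducible_poly_coprime // in bP.
have := coprimep_dvdr qb (coprimep_comp_poly phi bP).
by rewrite irreducible_poly_coprime ?qP //; case: pq.
Qed.

(** A representative of the block formed by the places q above P. *)
Definition chosen P : {poly F} :=
  if pselect (exists q, place q /\ q %| P \Po phi) is left h
  then sval (cid h) else 0.

Lemma chosenP q : place q -> place (chosen (below q)) /\
  chosen (below q) %| below q \Po phi.
Proof.
move=> pq; have [_ _ qb] := belowP pq.
by rewrite /chosen; case: pselect => [h|[]]; [case: cid|exists q].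
Qed.

(** On F(t1)^* E the valuation at q only depends on the polynomial below q,
    since there is no ramification. *)
Lemma valuation_below q u p r : place q -> fraction_of t1 u p r ->
  valuation q u = (mult (below q) p)%:Z - (mult (below q) r)%:Z.
Proof.
move=> pq up; have [p0 r0 _] := up; have [_ irr_b qb] := belowP pq.
rewrite (valuationE pq (fraction_comp up)).
by case: pq => _ irr_q qX; rewrite !(mult_comp char0 c0 m0 irr_q qX irr_b qb).
Qed.

(** The basis consists of the places other than the chosen one of their block,
    and the functional dual to q is v_q - v_d, with d the chosen place in the
    block of q: it vanishes on F(t1)^* E by [valuation_below]. The chosen places
    are recovered from P(phi) = product of the block of P, where each factor
    occurs once. *)
Lemma basis_rational_power : basis_mod (rational_units t1) (rational_units t)
  [set u | exists q, [/\ place q, q != chosen (below q) & u = poly_unit q]].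
Proof.
set B := [set u | _]; have BW : B `<=` rational_units t.
  by move=> _ [q [pq _ ->]]; exists q, 1; apply/poly_unit_fraction/place_neq0.
split=> // [|S gS CS BS].
- pose w b u : int :=
    valuation (place_of b) u - valuation (chosen (below (place_of b))) u.
  apply: (@dual_basis_independent _ _ _ _ w (rational_subgroup t)) => //.
  + move=> _ [q [pq _ ->]] x y Wx Wy; rewrite /w place_ofK //.
    have [pc _] := chosenP pq.
    by rewrite !valuationD // opprD addrACA.
  + move=> _ u [q [pq _ ->]] [p [r up]]; rewrite /w place_ofK //.
    have [pc qc] := chosenP pq; have [bm irr_b _] := belowP pq.
    by rewrite !(valuation_below _ up) // (below_unique pc bm irr_b qc) subrr.
  + move=> _ [q [pq qc ->]]; rewrite /w place_ofK // valuation_id //.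
    have [pc _] := chosenP pq.
    by rewrite valuation_distinct ?subr0 // eq_sym.
  + move=> _ _ [q [pq _ ->]] [d [pd dc ->]] qd; rewrite /w place_ofK //.
    have [pc qc] := chosenP pq; have [bm irr_b _] := belowP pq.
    rewrite !valuation_distinct ?subr0 //; last first.
      by apply: contraNneq qd => ->.
    apply: contraNneq dc => cd.
    by rewrite -{2}cd (below_unique pc bm irr_b qc) cd.
- have CS' : constant_units `<=` S := subset_trans (@constant_rational t1) CS.
  apply: rational_generated => // d pd.
  have [dc|dc] := eqVneq d (chosen (below d)); last by apply: BS; exists d.
  (* Here d is the chosen place: divide P(phi) by the rest s of its block. *)
  have [bm irr_b db] := belowP pd; have [dm irr_d dX] := pd.
  have [s sE] := dvdpP _ _ db.
  have b0 := irredp_neq0 irr_b; have bphi0 := comp_phi_neq0 b0.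
  have s0 : s != 0 by apply: contraNneq bphi0 => s0; rewrite sE s0 mul0r.
  have ds : ~~ (d %| s).
    have := mult_unramified char0 c0 m0 irr_d dX irr_b db.
    apply: contraPN => /dvdpP[s' s'E]; rewrite sE s'E.
    have s'0 : s' != 0 by apply: contraNneq s0 => s'0; rewrite s'E s'0 mul0r.
    have d0 := place_neq0 pd; rewrite !multM ?mulf_neq0 //.
    by rewrite mult_id // !addn1.
  have -> : poly_unit d = poly_unit (below d \Po phi) - poly_unit s.
    by rewrite sE (poly_unitM s0 (place_neq0 pd)) addrC addKr.
  apply: subgroupD => //; last first.
    apply: subgroupN => //; apply: poly_unit_generated => // e pe es.
    have be : below e = below d.
      by apply: below_unique => //; rewrite sE dvdp_mulr.
    apply: BS; exists e; split=> //; rewrite be -dc.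
    by apply: contraNneq ds => <-.
  apply: CS; exists (below d), 1; split; rewrite ?oner_eq0 //.
  exists 0; first exact: gE.1.
  by rewrite poly_unitE // eval_comp rmorph1 hornerC.
Qed.
End Ramification.
End Transcendental.
End RationalFunctions.

(** * Subfields as field types *)

(** The factorization theory of F[t] needs F to be a field type of its own,
    while the fields K(H) arise as subsets of K. *)
Record subfield_of (K : fieldType) (S : divringClosed K) := Subfield {
  subfield_val :> K;
  subfield_valP : subfield_val \in S
}.

Section SubfieldStructure.
Variables (K : fieldType) (S : divringClosed K).
HB.instance Definition _ := [isSub for @subfield_val K S].
HB.instance Definition _ := [Choice of subfield_of S by <:].
HB.instance Definition _ :=
  [SubChoice_isSubIntegralDomain of subfield_of S by <:].
HB.instance Definition _ :=
  [SubIntegralDomain_isSubField of subfield_of S by <:].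
End SubfieldStructure.

Lemma divring_structure (K : fieldType) (P : {pred K}) : divring_closed P ->
  exists S : divringClosed K, forall z, (z \in P) = (z \in S).
Proof.
move=> closedP.
pose S : divringClosed K := HB.pack P (GRing.isDivringClosed.Build K P closedP).
by exists S.
Qed.

Lemma subfield_embedding (K : fieldType) (P : {pred K}) : divring_closed P ->
  exists (F : fieldType) (iota : {rmorphism F -> K}),
    forall z, z \in P <-> exists a, z = iota a.
Proof.
move=> /divring_structure[S SE].
exists (subfield_of S : fieldType), (val : {rmorphism subfield_of S -> K}) => z.
rewrite SE; split=> [Sz|[a ->]]; last exact: subfield_valP.
by exists (Subfield Sz).
Qed.

(** * The fields K(H) *)

Section GroupAlgebra.
Variables (k : fieldType) (G : torsionFreeZmodType).
Local Notation kG := (groupAlg k G).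
Local Notation gm := (@gmon k G).
Implicit Types (H L : set G) (p q : kG) (g h x y : G).

Definition supported H : set kG := [set p | forall g, mcoeff g p != 0 -> H g].

Lemma supportedW H L p : H `<=` L -> supported H p -> supported L p.
Proof. by move=> HL Hp g /Hp/HL. Qed.

Lemma supported0 H : supported H 0.
Proof. by move=> g; rewrite mcoeff0 eqxx. Qed.

Lemma supportedD H p q : supported H p -> supported H q -> supported H (p + q).
Proof.
move=> Hp Hq g; rewrite mcoeffD.
have [p0|/Hp //] := eqVneq (mcoeff g p) 0; rewrite p0 add0r.
exact: Hq.
Qed.

Lemma supportedN H p : supported H p -> supported H (- p).
Proof. by move=> Hp g; rewrite mcoeffN oppr_eq0; apply: Hp. Qed.

Lemma supported_mon H g (c : k) : H g -> supported H (c *: gm g).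
Proof.
move=> Hg h; rewrite scale_gmon mcoeffU.
by case: (g =P h) => [<- //|_]; rewrite mulr0n eqxx.
Qed.

Lemma supported_gmon H g : H g -> supported H (gm g).
Proof. by rewrite -[gm g]scale1r; apply: supported_mon. Qed.

Lemma mon_ind H (S : kG -> Prop) p : supported H p -> S 0 ->
  (forall p1 p2, S p1 -> S p2 -> S (p1 + p2)) ->
  (forall c g, H g -> S (c *: gm g)) -> S p.
Proof.
move=> Hp S0 SD Smon; rewrite (monalgE p) big_seq; apply: (big_ind S) => // g.
by rewrite -mcoeff_neq0 => /Hp Hg; rewrite -scale_gmon; apply: Smon.
Qed.

Lemma mcoeff_mulmon p g h : mcoeff h (p * gm g) = mcoeff (h - g) p.
Proof.
pose S p := mcoeff h (p * gm g) = mcoeff (h - g) p.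
apply: (@mon_ind setT S p) => // [|p1 p2 IH1 IH2|c l _]; rewrite /S.
- by rewrite mul0r !mcoeff0.
- by rewrite mulrDl !mcoeffD IH1 IH2.
- rewrite -gscaleAl -gmonD !mcoeffZ !mcoeffU; congr (_ * (_ *+ _)).
  by rewrite eq_sym [l == _]eq_sym subr_eq.
Qed.

Variables (K : fieldType) (emb : {rmorphism kG -> K}).
Hypothesis emb_inj : injective emb.
Implicit Type z : K.

Lemma emb_eq0 p : (emb p == 0) = (p == 0).
Proof. by rewrite -(inj_eq emb_inj) rmorph0. Qed.

Section Subgroup.
Variable H : set G.
Hypothesis gH : subgroup H.

Lemma supportedM p q : supported H p -> supported H q -> supported H (p * q).
Proof.
move=> Hp Hq; apply: (@mon_ind H (fun q => supported H (p * q)) q Hq)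
  => [|q1 q2 IH1 IH2|c g Hg].
- by rewrite mulr0; apply: supported0.
- by rewrite mulrDr; apply: supportedD.
move=> h; rewrite mulrC -gscaleAl mulrC mcoeffZ mcoeff_mulmon mulf_eq0 negb_or.
by case/andP=> _ /Hp Hhg; rewrite -(subrK g h); apply: subgroupD.
Qed.

Lemma supported1 : supported H 1.
Proof. exact: (@supported_gmon H 0 gH.1). Qed.

Definition fracs : {pred K} := fun z => `[< exists p q,
  [/\ supported H p, supported H q, q != 0 & z = emb p / emb q] >].

Lemma emb_neq0 p : p != 0 -> emb p != 0.
Proof. by rewrite emb_eq0. Qed.

Lemma fracs_emb p : supported H p -> emb p \in fracs.
Proof.
move=> Hp; apply/asboolP; exists p, 1; rewrite oner_eq0 rmorph1 divr1.
by split=> //; exact: supported1.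
Qed.

Lemma fracs_closed : divring_closed fracs.
Proof.
split=> [|x y /asboolP[p [q [Hp Hq q0 ->]]] /asboolP[p' [q' [Hp' Hq' q'0 ->]]]|
  x y /asboolP[p [q [Hp Hq q0 ->]]] /asboolP[p' [q' [Hp' Hq' q'0 ->]]]].
- by rewrite -(rmorph1 emb); apply/fracs_emb/supported1.
- apply/asboolP; exists (p * q' - p' * q), (q * q'); split.
  + by apply: supportedD; [|apply: supportedN]; apply: supportedM.
  + exact: supportedM.
  + exact: mulf_neq0.
  + rewrite rmorphB !rmorphM -[- (emb p' / _)]mulNr addf_div ?emb_neq0 //.
    by rewrite mulNr.
- have [->|p'0] := eqVneq p' 0.
    rewrite rmorph0 mul0r invr0 mulr0 -(rmorph0 emb).
    by apply: fracs_emb; apply: supported0.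
  apply/asboolP; exists (p * q'), (q * p'); split.
  + exact: supportedM.
  + exact: supportedM.
  + exact: mulf_neq0.
  + by rewrite !rmorphM invf_div mulf_div.
Qed.

Definition Xmon g : K := emb (gm g).

Lemma Xmon_neq0 g : Xmon g != 0.
Proof. by rewrite emb_eq0 monalgU_eq0 oner_eq0. Qed.

Lemma Xmon0 : Xmon 0 = 1.
Proof. exact: rmorph1. Qed.

Lemma XmonD g h : Xmon (g + h) = Xmon g * Xmon h.
Proof. by rewrite /Xmon gmonD rmorphM. Qed.

Lemma XmonN g : Xmon (- g) = (Xmon g)^-1.
Proof.
apply: (mulfI (Xmon_neq0 g)); rewrite -XmonD subrr Xmon0 mulfV //.
exact: Xmon_neq0.
Qed.

Lemma XmonMn g n : Xmon (g *+ n) = Xmon g ^+ n.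
Proof.
by elim: n => [|n IHn]; rewrite ?mulr0n ?Xmon0 // mulrS XmonD IHn exprS.
Qed.

Lemma common_denominator (a : nat -> K) n :
  (forall i, (i < n)%N -> a i \in fracs) ->
  exists d b, [/\ d != 0, supported H d, forall i, supported H (b i)
    & forall i, (i < n)%N -> a i * emb d = emb (b i)].
Proof.
elim: n => [_|n IHn aH].
  exists 1, (fun=> 0); split=> //; first exact: oner_neq0.
    exact: supported1.
  by move=> _; apply: supported0.
have [d [b [d0 Hd Hb ab]]] := IHn (fun i lt_in => aH i (ltnW lt_in)).
have /asboolP[p [q [Hp Hq q0 an]]] := aH n (ltnSn n).
exists (d * q), (fun i => if i == n then p * d else b i * q); split.
- exact: mulf_neq0.
- exact: supportedM.
- by move=> i; case: eqP => _; apply: supportedM.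
- move=> i; rewrite ltnS leq_eqVlt; case: eqP => [-> _|_ /= /ab abi].
    by rewrite an !rmorphM mulrA mulrAC divfK ?emb_neq0.
  by rewrite !rmorphM mulrA abi.
Qed.

(** K(G) contains the direct sum of the K(H) X^x over representatives x of the
    cosets of H: after clearing denominators, the terms b i * X^(x i) have
    disjoint supports. Both the transcendence of X^x over K(H) and the fact that
    X^g lies in K(H) only for g in H are instances of this. *)
Lemma cosets_independent n (a : nat -> K) (x : nat -> G) :
  (forall i, (i < n)%N -> a i \in fracs) ->
  (forall i j, (i < n)%N -> (j < n)%N -> H (x i - x j) -> i = j) ->
  \sum_(i < n) a i * Xmon (x i) = 0 -> forall i, (i < n)%N -> a i = 0.
Proof.
move=> aH xH sum0 j jn.
have [d [b [d0 Hd Hb ab]]] := common_denominator aH.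
have : \sum_(i < n) b i * gm (x i) = 0.
  apply/eqP; rewrite -(emb_eq0) rmorph_sum /=; apply/eqP.
  rewrite -[RHS](mul0r (emb d)) -[X in X * _]sum0 mulr_suml.
  apply: eq_bigr => i _.
  by rewrite rmorphM -ab // mulrAC.
move=> sumb0; have bj0 : b j = 0.
  apply/malgP => h; rewrite mcoeff0; apply/eqP/negPn/negP => bjh.
  have /eqP := congr1 (mcoeff (h + x j)) sumb0.
  rewrite mcoeff0 raddf_sum (bigD1 (Ordinal jn)) //= mcoeff_mulmon addrK.
  rewrite big1 ?addr0 ?(negbTE bjh) // => i ij; rewrite mcoeff_mulmon.
  apply/eqP/negPn/negP => /Hb Hi; case/eqP: ij; apply: val_inj => /=.
  apply: (xH) => //; rewrite -[_ - _]opprK opprB; apply: subgroupN => //.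
  rewrite -(addKr h (x j - x i)) [- h + _]addrC addrA; apply: gH.2 => //.
  exact: Hb bjh.
have := ab _ jn; rewrite bj0 rmorph0 => /eqP; rewrite mulf_eq0 emb_eq0.
by rewrite (negbTE d0) orbF => /eqP.
Qed.

Lemma Xmon_fracs g : Xmon g \in fracs <-> H g.
Proof.
split=> [Hg|Hg]; last first.
  by apply: fracs_emb; apply: supported_gmon.
apply: contrapT => nHg.
(* Otherwise 1 * X^g - X^g * X^0 = 0 is a relation between the cosets of g and 0
   with coefficients 1 and - X^g in K(H). *)
pose a i : K := if i == 0%N then 1 else - Xmon g.
pose x i : G := if i == 0%N then g else 0.
suff /eqP : a 0%N = 0 by rewrite oner_eq0.
apply: (@cosets_independent 2 a x) => //.
- have [S SE] := divring_structure fracs_closed.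
  by move=> i _; rewrite SE /a; case: eqP => _; rewrite ?rpredN ?rpred1 -?SE.
- case=> [|[]] // [|[]] // _ _; rewrite /x /= ?subr0 // sub0r.
  by move=> /(subgroupN gH); rewrite opprK.
- by rewrite !big_ord_recl big_ord0 /a /x /= Xmon0 mul1r mulr1 addr0 subrr.
Qed.

End Subgroup.
(** * Adjoining one group element *)

Lemma fracsW H L z : H `<=` L -> z \in fracs H -> z \in fracs L.
Proof.
move=> HL /asboolP[p [q [Hp Hq q0 ->]]]; apply/asboolP; exists p, q; split=> //.
  exact: supportedW Hp.
exact: supportedW Hq.
Qed.

Definition monomial_group : set (fieldUnits K) :=
  [set u | exists g, fuval u = Xmon g].

Lemma monomial_group_subgroup : subgroup monomial_group.
Proof.
split=> [|u v [g ug] [h vh]]; first by exists 0; rewrite Xmon0.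
by exists (g - h); rewrite fuvalD fuvalN ug vh XmonD XmonN.
Qed.

(** This is W(H) = K(H)^* X^G. Allowing monomials with exponents in all of G,
    and not only in H, makes the quotients W(H')/W(H) those of a chain of
    subgroups of one fixed group. *)
Definition level H : set (fieldUnits K) :=
  [set u | exists z g, z \in fracs H /\ fuval u = z * Xmon g].

Lemma levelW H L : H `<=` L -> level H `<=` level L.
Proof.
by move=> HL u [z [g [Hz uz]]]; exists z, g; split=> //; apply: fracsW Hz.
Qed.

Definition adjoin H x : set G := [set y | exists n : int, H (y - x *~ n)].

Lemma adjoin_subgroup H x : subgroup H -> subgroup (adjoin H x).
Proof.
move=> gH; split=> [|y z [n Hy] [m Hz]].
  by exists 0; rewrite mulr0z subr0; apply: gH.1.
by exists (n - m); rewrite mulrzBr opprD addrACA -opprD; apply: gH.2.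
Qed.

Lemma adjoinW H x : H `<=` adjoin H x.
Proof. by move=> h Hh; exists 0; rewrite mulr0z subr0. Qed.

Lemma adjoin_id H x : subgroup H -> adjoin H x x.
Proof. by move=> gH; exists 1; rewrite mulr1z subrr; apply: gH.1. Qed.

Definition pure H := forall n y, (0 < n)%N -> H (y *+ n) -> H y.

Lemma pure_int H x (n : int) :
  subgroup H -> pure H -> H (x *~ n) -> ~ H x -> n = 0.
Proof.
move=> gH pH Hn nHx; case: n Hn => [[|n]|n] //.
  by rewrite -pmulrn => /pH Hx; case: nHx; apply: Hx.
rewrite NegzE mulrNz => /(subgroupN gH); rewrite opprK => /pH Hx.
by case: nHx; apply: Hx.
Qed.

Section AdjoinOne.
Variables (H : set G) (x : G).
Hypotheses (gH : subgroup H) (pH : pure H) (nHx : ~ H x).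
Variables (F : fieldType) (iota : {rmorphism F -> K}).
Hypothesis iotaP : forall z, z \in fracs H <-> exists a, z = iota a.
Local Notation t := (Xmon x).
Local Notation eval p := (map_poly iota p).[t].

Lemma level_constant : level H = constant_units iota monomial_group.
Proof.
apply/seteqP; split=> u.
  move=> [z [g [/iotaP[a ->] ug]]]; have ua0 := fuval_neq0 u.
  have e0 := Xmon_neq0 g.
  exists a, (to_unit (Xmon g)); split; last by rewrite to_unitK.
    by apply: contraNneq ua0 => a0; rewrite ug a0 rmorph0 mul0r.
  by exists g; rewrite to_unitK.
move=> [a [e [a0 [g eg] ue]]]; exists (iota a), g; split; last by rewrite -eg.
by apply/iotaP; exists a.
Qed.

(** As H is pure and x is outside H, the multiples of x lie in distinct cosets
    of H. *)
Lemma transcendental_Xmon : transcendental iota t.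
Proof.
move=> p; rewrite horner_coef size_map_poly => p0; apply/polyP => i.
rewrite coef0; have [i_ge|i_lt] := leqP (size p) i; first exact: nth_default.
apply: (fmorph_inj iota); rewrite rmorph0.
apply: (@cosets_independent H gH (size p) (fun i => iota p`_i)
  (fun i => x *+ i)) i_lt => [j _|j l _ _ Hjl|].
- by apply/iotaP; exists p`_j.
- suff : (j%:Z - l%:Z)%R = 0 by move/eqP; rewrite subr_eq0 => /eqP[].
  by apply: (pure_int gH pH _ nHx); rewrite mulrzBr -!pmulrn.
- by rewrite -[RHS]p0; apply: eq_bigr => j _; rewrite coef_map XmonMn.
Qed.

Lemma fracs_adjoin_ratio (p r : {poly F}) :
  eval p / eval r \in fracs (adjoin H x).
Proof.
have gL := adjoin_subgroup x gH.
have [S SE] := divring_structure (fracs_closed gL).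
suff Seval (q : {poly F}) : eval q \in S by rewrite SE rpred_div ?Seval.
rewrite horner_coef; apply: rpred_sum => i _; rewrite coef_map /=.
apply: rpredM; rewrite -SE.
  by apply: fracsW (@adjoinW H x) _; apply/iotaP; exists q`_i.
by rewrite SE rpredX // -SE; apply/(Xmon_fracs gL)/adjoin_id.
Qed.

Lemma eval_Xmon_neq0 (p : {poly F}) : p != 0 -> eval p != 0.
Proof. by apply: contra_neq; apply: transcendental_Xmon. Qed.

Lemma monomials_only_Xmon : monomials_only iota monomial_group t.
Proof.
move=> e p r [g eg] /eval_Xmon_neq0 r0 er.
have : adjoin H x g.
  apply/(Xmon_fracs (adjoin_subgroup x gH)); rewrite -eg.
  by rewrite -(mulfK r0 (fuval e)) er; apply: fracs_adjoin_ratio.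
case=> n /(Xmon_fracs gH)/iotaP[a aE]; exists a.
have a0 : a != 0.
  by have := Xmon_neq0 (g - x *~ n); rewrite aE fmorph_eq0.
case: n aE => n aE.
  exists 0%N, n; split=> //; rewrite mulr1 eg -aE -XmonMn -XmonD.
  by rewrite -pmulrn subrK.
exists n.+1, 0%N; split=> //; rewrite mulr1 eg -aE -XmonMn -XmonD.
by rewrite NegzE mulrNz opprK.
Qed.

(** Elements of k[H + Zx] are Laurent polynomials in X^x over K(H). *)
Lemma supported_adjoin p : supported (adjoin H x) p ->
  exists q r : {poly F}, r != 0 /\ emb p * eval r = eval q.
Proof.
move=> Lp; pose S p := exists q r : {poly F}, r != 0 /\ emb p * eval r = eval q.
apply: (@mon_ind (adjoin H x) S p Lp)
  => [|p1 p2 [q1 [r1 [r10 e1]]] [q2 [r2 [r20 e2]]]|c g [n Hn]].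
- by exists 0, 1; rewrite oner_eq0 !rmorph0 horner0 mul0r.
- exists (q1 * r2 + q2 * r1), (r1 * r2); split; first exact: mulf_neq0.
  rewrite !rmorphD !rmorphM hornerD !hornerM -e1 -e2 mulrDl.
  by rewrite mulrA [in X in _ + X]mulrCA [eval r1 * _]mulrC.
- have /iotaP[a aE] : emb (c *: gm (g - x *~ n)) \in fracs H.
    by apply: fracs_emb => //; apply: supported_mon.
  have gE : emb (c *: gm g) = iota a * Xmon (x *~ n).
    by rewrite -aE -rmorphM -gscaleAl -gmonD subrK.
  case: n Hn aE gE => n _ _ gE.
    exists (a%:P * 'X^n), 1; rewrite oner_eq0 rmorph1 hornerC mulr1; split=> //.
    rewrite gE rmorphM hornerM /= map_polyC map_polyXn hornerC hornerXn.
    by rewrite -XmonMn.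
  exists a%:P, 'X^(n.+1); split; first by rewrite expf_neq0 ?polyX_eq0.
  rewrite map_polyXn map_polyC hornerC hornerXn gE -XmonMn -mulrA -XmonD.
  by rewrite NegzE mulrNz addNr Xmon0 mulr1.
Qed.

Lemma level_rational :
  level (adjoin H x) = rational_units iota monomial_group t.
Proof.
apply/seteqP; split=> u.
  move=> [z [g [/asboolP[p [q [Lp Lq q0 ->]]] ug]]].
  have [p' [r [r0 pE]]] := supported_adjoin Lp.
  have [q' [s [s0 qE]]] := supported_adjoin Lq.
  have p0 : p != 0.
    apply: contraNneq (fuval_neq0 u) => p0.
    by rewrite ug p0 rmorph0 !mul0r.
  have nz p1 (p2 r1 : {poly F}) :
      p1 != 0 -> r1 != 0 -> emb p1 * eval r1 = eval p2 -> p2 != 0.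
    move=> p10 r10 e; apply: contra_neq (eval_Xmon_neq0 r10) => p20.
    move/eqP: e; rewrite p20 rmorph0 horner0 mulf_eq0 emb_eq0 (negbTE p10) /=.
    by move/eqP.
  have p'0 := nz _ _ _ p0 r0 pE; have q'0 := nz _ _ _ q0 s0 qE.
  exists (p' * s), (r * q'); split; try exact: mulf_neq0.
  exists (to_unit (Xmon g)); first by exists g; rewrite to_unitK ?Xmon_neq0.
  rewrite to_unitK ?Xmon_neq0 // ug !rmorphM !hornerM -pE -qE.
  have eq0 := emb_neq0 q0.
  rewrite mulrAC; congr (_ * _); rewrite -!mulrA; congr (_ * _).
  by rewrite mulrCA [(emb q)^-1 * _]mulrA mulVf // mul1r.
move=> [p [r [p0 r0 [e [g eg] ue]]]].
exists (eval p / eval r), g; split; first exact: fracs_adjoin_ratio.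
by rewrite mulrAC -eg -ue mulfK ?eval_Xmon_neq0.
Qed.

End AdjoinOne.

Lemma pchar0_subfield (F : fieldType) (iota : {rmorphism F -> K}) :
  [pchar k]%R =i pred0 -> [pchar F]%R =i pred0.
Proof.
move=> /pcharf0P kchar; apply/pcharf0P => n; rewrite -(fmorph_eq0 iota).
rewrite rmorph_nat -(rmorph_nat emb) emb_eq0 -kchar.
have -> : n%:R = n%:R *: gm 0 :> kG by rewrite scaler_nat.
by rewrite scale_gmon monalgU_eq0.
Qed.

Lemma basis_adjoin H x : subgroup H -> pure H -> ~ H x ->
  exists B, basis_mod (level H) (level (adjoin H x)) B.
Proof.
move=> gH pH nHx; have [F [iota iotaP]] := subfield_embedding (fracs_closed gH).
rewrite (level_constant iotaP) (level_rational gH pH nHx iotaP).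
have tE : fuval (to_unit (Xmon x)) = Xmon x by rewrite to_unitK ?Xmon_neq0.
eexists; rewrite -tE; apply: basis_rational_constant; rewrite ?tE.
- exact: monomial_group_subgroup.
- by exists x; rewrite tE.
- exact: transcendental_Xmon iotaP.
- exact: (monomials_only_Xmon gH pH nHx iotaP).
Qed.

Lemma adjoinN H x : adjoin H (- x) = adjoin H x.
Proof.
apply/seteqP; split=> y [n Hy]; exists (- n); move: Hy.
  by rewrite mulNrz mulrNz.
by rewrite mulNrz mulrNz opprK.
Qed.

(** If x = h + m y with h in H then X^x = X^h (X^y)^m; replacing y by - y, which
    does not change H + Zy, makes the exponent m positive. *)
Lemma basis_adjoin_root H x y : [pchar k]%R =i pred0 ->
  subgroup H -> pure H -> ~ H x -> ~ H y -> adjoin H y x ->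
  exists B, basis_mod (level (adjoin H x)) (level (adjoin H y)) B.
Proof.
move=> char0 gH pH nHx nHy [m Hm].
wlog m_gt0 : y m nHy Hm / exists n, m = n.+1%:Z.
  move=> gen; case: m Hm => [[|n]|n] Hm.
  - by rewrite mulr0z subr0 in Hm.
  - by apply: (gen y n.+1) => //; exists n.
  rewrite -(adjoinN H y); apply: (gen (- y) n.+1); last by exists n.
  - by move/(subgroupN gH); rewrite opprK.
  - by move: Hm; rewrite NegzE mulrNz mulNrz.
have [n mE] := m_gt0; rewrite mE in Hm => {m m_gt0 mE}.
have [F [iota iotaP]] := subfield_embedding (fracs_closed gH).
rewrite (level_rational gH pH nHx iotaP) (level_rational gH pH nHy iotaP).
have [c cE] : exists c, Xmon (x - y *~ n.+1) = iota c.
  by apply/iotaP/(Xmon_fracs gH).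
have c0 : c != 0.
  by have := Xmon_neq0 (x - y *~ n.+1); rewrite cE fmorph_eq0.
have xE : Xmon x = iota c * Xmon y ^+ n.+1.
  by rewrite -cE -XmonMn -XmonD -pmulrn subrK.
have tE : fuval (to_unit (Xmon y)) = Xmon y by rewrite to_unitK ?Xmon_neq0.
eexists; rewrite xE -tE; apply: basis_rational_power; rewrite ?tE //.
- exact: monomial_group_subgroup.
- by exists y; rewrite tE.
- exact: transcendental_Xmon iotaP.
- exact: (monomials_only_Xmon gH pH nHy iotaP).
- exact: pchar0_subfield iota char0.
Qed.

(** * Pure extensions of rank one *)

Definition division H x n : set G := [set y | adjoin H x (y *+ n)].

Lemma division_subgroup H x n : subgroup H -> subgroup (division H x n).
Proof.
move=> /(adjoin_subgroup x) gL; split=> [|y z Ly Lz].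
  by rewrite /division /= mul0rn; apply: gL.1.
by rewrite /division /= mulrnBl; apply: gL.2.
Qed.

Lemma division_dvd H x n m : subgroup H -> (n %| m)%N ->
  division H x n `<=` division H x m.
Proof.
move=> gH /dvdnP[l ->] y Ly; rewrite /division /= mulnC mulrnA.
by apply: subgroupMn => //; apply: adjoin_subgroup.
Qed.

(** Modulo H, the group {z | n z in H + Zx} embeds in Z by sending z to the
    integer a with n z = a x; the image is an ideal of Z, generated by its least
    positive element d, and y is a preimage of d. *)
Lemma division_adjoin H x n : subgroup H -> pure H -> ~ H x -> (0 < n)%N ->
  exists2 y, ~ H y & division H x n = adjoin H y.
Proof.
move=> gH pH nHx n0.
pose D d := (0 < d)%N && `[< exists y, H (y *+ n - x *+ d) >].
have exD : exists d, D d.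
  exists n; rewrite /D n0; apply/asboolP; exists x; rewrite subrr.
  exact: gH.1.
have [d /andP[d0 /asboolP[y Hy]] min_d] := ex_minnP exD.
exists y.
  (* If y were in H, so would be d x, hence x. *)
  move=> /(subgroupMn n gH) Hyn; apply: nHx; apply: pH d0 _.
  by rewrite -(subKr (y *+ n) (x *+ d)); apply: gH.2.
have swap j : y *~ j *+ n = y *+ n *~ j by rewrite !pmulrn -!mulrzA mulrC.
apply/seteqP; split=> z; last first.
  case=> j Hj; exists (d%:Z * j).
  have -> : z *+ n - x *~ (d%:Z * j) =
      (z - y *~ j) *+ n + (y *+ n - x *+ d) *~ j.
    by rewrite mulrnBl mulrzBl swap addrA subrK mulrzA.
  by apply: subgroupD; [|apply: subgroupMn|apply: subgroupMz].
case=> a Ha; exists (a %/ d)%Z; apply: (pH n) => //.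
have Hr : H ((z - y *~ (a %/ d)%Z) *+ n - x *~ (a %% d)%Z).
  have aE : a = d%:Z * (a %/ d)%Z + (a %% d)%Z by rewrite mulrC -divz_eq.
  move: (a %/ d)%Z (a %% d)%Z aE => q r aE.
  have -> : (z - y *~ q) *+ n - x *~ r =
      (z *+ n - x *~ a) - (y *+ n - x *+ d) *~ q.
    rewrite aE mulrzDr mulrzA mulrnBl mulrzBl swap opprB -!addrA.
    by congr (_ + _); rewrite [RHS]addrC opprD addrACA subrr add0r.
  by apply: gH.2 => //; apply: subgroupMz.
have r0 : (0 <= a %% d)%Z by rewrite modz_ge0 // eqz_nat -lt0n.
have rd : (a %% d < d)%Z by rewrite ltz_pmod.
case: (a %% d)%Z r0 rd Hr => // r _; rewrite ltz_nat => rd Hr.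
have [r0|r0] := posnP r; first by rewrite r0 mulr0z subr0 in Hr.
have : D r by rewrite /D r0; apply/asboolP; exists (z - y *~ (a %/ d)%Z).
by move/min_d; rewrite leqNgt rd.
Qed.

(** Numerator and denominator of a fraction have finite supports. *)
Lemma level_directed (I : Type) (J : set I) (L : I -> set G) :
  J !=set0 ->
  (forall i j, J i -> J j -> exists2 l, J l & L i `<=` L l /\ L j `<=` L l) ->
  level (\bigcup_(i in J) L i) `<=` \bigcup_(i in J) level (L i).
Proof.
move=> [i0 Ji0] dirL u [z [g [/asboolP[p [q [Up Uq q0 zE]]] ug]]].
have fin r : supported (\bigcup_(i in J) L i) r ->
    exists2 i, J i & supported (L i) r.
  move=> Ur.
  apply: (@mon_ind _ (fun r => exists2 i, J i & supported (L i) r) r Ur).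
  - by exists i0 => //; apply: supported0.
  - move=> r1 r2 [i Ji ir] [j Jj jr]; have [l Jl [il jl]] := dirL i j Ji Jj.
    exists l => //.
    by apply: supportedD; [apply: supportedW ir|apply: supportedW jr].
  - by move=> c h [i Ji ih]; exists i => //; apply: supported_mon.
have [[i Ji ip] [j Jj jq]] := (fin _ Up, fin _ Uq).
have [l Jl [il jl]] := dirL i j Ji Jj; exists l => //; exists z, g; split=> //.
apply/asboolP; exists p, q; split=> //; first exact: supportedW ip.
exact: supportedW jq.
Qed.

Lemma level_subgroup H : subgroup H -> subgroup (level H).
Proof.
move=> gH; have [S SE] := divring_structure (fracs_closed gH).
split=> [|u v [z [g [Hz ug]]] [w [h [Hw vh]]]].
  by exists 1, 0; rewrite SE rpred1 Xmon0 mulr1.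
exists (z / w), (g - h); rewrite SE rpred_div -?SE //; split=> //.
by rewrite fuvalD fuvalN ug vh XmonD XmonN mulrACA invfM.
Qed.

(** The smallest pure subgroup containing H and x, for H a subgroup. Factorials
    make the union increasing, one index dividing the next. *)
Definition division_closure H x : set G := \bigcup_n division H x n`!.

Lemma division_closureE H x y : subgroup H ->
  division_closure H x y <-> exists2 n, (0 < n)%N & division H x n y.
Proof.
move=> gH; split=> [[n _ Ln]|[n n0 Ln]].
  by exists n`! => //; apply: fact_gt0.
exists n => //; apply: (division_dvd gH) Ln.
by case: n n0 => // n _; rewrite factS dvdn_mulr.
Qed.

Lemma division_incr H x n m : subgroup H -> (n <= m)%N ->
  division H x n`! `<=` division H x m`!.
Proof.
move=> gH nm; apply: division_dvd => //.
by rewrite -(subnKC nm); elim: (m - n)%N => [|l IHl];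
  rewrite ?addn0 // addnS factS dvdn_mull.
Qed.

Lemma division_closure_subgroup H x : subgroup H ->
  subgroup (division_closure H x).
Proof.
move=> gH; split=> [|y z [n _ yn] [m _ zm]].
  by exists 0%N => //; apply: (division_subgroup _ _ gH).1.
exists (maxn n m) => //; apply: (division_subgroup _ _ gH).2.
  by apply: (division_incr gH _ yn); rewrite leq_maxl.
by apply: (division_incr gH _ zm); rewrite leq_maxr.
Qed.

Lemma division_closure_pure H x : subgroup H -> pure (division_closure H x).
Proof.
move=> gH n y n0 /(division_closureE _ _ gH)[m m0 ym].
apply/(division_closureE _ _ gH); exists (n * m)%N.
  by rewrite muln_gt0 n0.
by rewrite /division /= mulrnA.
Qed.

Lemma division_closureW H x : subgroup H -> H `<=` division_closure H x.
Proof.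
move=> gH y Hy; exists 0%N => //; rewrite /division /= mulr1n.
exact: adjoinW.
Qed.

Lemma division_closure_id H x : subgroup H -> division_closure H x x.
Proof.
by move=> gH; exists 0%N => //; rewrite /division /= mulr1n; apply: adjoin_id.
Qed.

Lemma basis_division_closure H x : [pchar k]%R =i pred0 ->
  subgroup H -> pure H -> ~ H x ->
  exists B, basis_mod (level H) (level (division_closure H x)) B.
Proof.
move=> char0 gH pH nHx; pose L n := division H x n`!.
have gL n : subgroup (L n) by apply: division_subgroup.
have HL n : H `<=` L n.
  apply: subset_trans (division_incr gH (leq0n n)) => y Hy.
  by rewrite /division /= mulr1n; apply: adjoinW.
have Lincr n : L n `<=` L n.+1 by apply: division_incr.
pose M n := if n is m.+1 then level (L m) else level H.
have /choice[y yP] n : exists y, ~ H y /\ L n = adjoin H y.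
  by have [y nHy LE] := division_adjoin gH pH nHx (fact_gt0 n); exists y.
have [n|n|n|B basB] := @basis_mod_nat _ M.
- by case: n => [|n]; apply: level_subgroup.
- by case: n => [|n]; apply: levelW.
- case: n => [|n] /=.
    by have [ny ->] := yP 0%N; apply: basis_adjoin.
  have [[ny LE] [ny' LE']] := (yP n, yP n.+1); rewrite LE LE'.
  apply: basis_adjoin_root => //; rewrite -LE'; apply: Lincr; rewrite LE.
  exact: adjoin_id.
exists B; have -> // : level (division_closure H x) = \bigcup_n M n.
apply/seteqP; split.
  apply: subset_trans (@level_directed _ setT L _ _) _ => [|i j _ _|u [n _ un]].
  - by exists 0%N.
  - exists (maxn i j) => //.
    by split; apply: division_incr => //; rewrite ?leq_maxl ?leq_maxr.
  - by exists n.+1.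
move=> u [[|n] _ /=]; apply: levelW => z; first by move/(HL 0%N); exists 0%N.
by exists n.
Qed.

(** * Exhausting the group *)

Lemma level0 : level [set 0] =
  [set u | exists (c : k) g, c != 0 /\ fuval u = emb (c *: gm g)].
Proof.
have g0 : subgroup [set 0 : G] by split=> // x y -> ->; rewrite /= subr0.
have supp0 p : supported [set 0] p -> p = mcoeff 0 p *: gm 0.
  move=> p0; apply/malgP => h; rewrite scale_gmon mcoeffU.
  have [-> //|h0] := eqVneq 0 h; rewrite mulr0n.
  apply/eqP/negPn/negP => /p0 /= hE.
  by rewrite hE eqxx in h0.
apply/seteqP; split=> u /=; last first.
  move=> [c [g [c0 ug]]]; exists (emb (c *: gm 0)), g; split.
    by apply: fracs_emb => //; apply: supported_mon.
  by rewrite ug -rmorphM -gscaleAl -gmonD add0r.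
move=> [z [g [/asboolP[p [q [/supp0 pE /supp0 qE q0 zE]]] ug]]].
set a := mcoeff 0 p in pE; set b := mcoeff 0 q in qE.
have b0 : b != 0 by apply: contraNneq q0 => b0; rewrite qE b0 scale0r.
have uE : fuval u = emb ((a / b) *: gm g).
  rewrite ug zE mulrAC; apply: (canLR (mulfK (emb_neq0 q0))).
  have monM c d g' h : (c *: gm g') * (d *: gm h) = (c * d) *: gm (g' + h).
    by rewrite !scale_gmon; apply: gmulUU.
  by rewrite -!rmorphM -[gm g in LHS]scale1r pE qE !monM addrC mulr1 divfK.
exists (a / b), g; split=> //; apply: contraNneq (fuval_neq0 u) => ab0.
by rewrite uE ab0 scale0r rmorph0.
Qed.

Lemma levelT : (forall z, exists p q, q != 0 /\ z = emb p / emb q) ->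
  level setT = setT.
Proof.
move=> fracK; apply/seteqP; split=> // u _.
have [p [q [q0 uE]]] := fracK (fuval u).
exists (fuval u), 0; rewrite Xmon0 mulr1; split=> //.
by apply/asboolP; exists p, q.
Qed.

(** A set X in the disjoint sum of G and K^* encodes the pair formed of the
    subgroup [Hof X] and the basis [Bof X], so that the extension order on pairs
    becomes inclusion. Adding 0 by hand in [Hof] lets the empty set, the union
    of the empty chain, encode the trivial subgroup. *)
Lemma basis_level : [pchar k]%R =i pred0 ->
  exists B, basis_mod (level [set 0]) (level setT) B.
Proof.
move=> char0; have g0 : subgroup [set 0 : G].
  by split=> // x y -> ->; rewrite /= subr0.
pose Hof (X : set (G + fieldUnits K)) : set G := [set x | x = 0 \/ X (inl x)].
pose Bof (X : set (G + fieldUnits K)) : set (fieldUnits K) :=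
  [set b | X (inr b)].
pose P X := [/\ subgroup (Hof X), pure (Hof X)
  & basis_mod (level [set 0]) (level (Hof X)) (Bof X)].
have [C CP Ctot|X [[gH pH bas] maxX]] := @Zorn_bigcup _ P.
  have [->|/set0P C0] := eqVneq C set0.
    rewrite bigcup_set0 /P.
    have -> : Hof set0 = [set 0] by apply/seteqP; split=> x; [case|left].
    split=> //; last exact: basis_mod0.
    by move=> n y n0 /(torsion_free _ _ n0).
  have incH X Y : X `<=` Y -> Hof X `<=` Hof Y.
    by move=> XY x [->|/XY Yx]; [left|right].
  have dirC X Y : C X -> C Y -> exists2 Z, C Z & X `<=` Z /\ Y `<=` Z.
    by move=> CX CY; have [XY|YX] := Ctot X Y CX CY; [exists Y|exists X];
      rewrite ?CX ?CY //; split.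
  have HU : Hof (\bigcup_(X in C) X) = \bigcup_(X in C) Hof X.
    apply/seteqP; split=> x.
      case=> [->|[X CX Xx]]; last by exists X => //; right.
      by have [X CX] := C0; exists X => //; left.
    by case=> X CX; apply: incH => w Xw; exists X.
  split; rewrite ?HU.
  - split=> [|x y [X CX Xx] [Y CY Yy]].
      by have [X CX] := C0; exists X => //; left.
    have [Z CZ [XZ YZ]] := dirC X Y CX CY; exists Z => //.
    by have [[_ ZB] _ _] := CP Z CZ; apply: ZB; [apply: incH Xx|apply: incH Yy].
  - move=> n y n0 [X CX Xy]; exists X => //.
    by have [_ pX _] := CP X CX; apply: pX Xy.
  - have -> : Bof (\bigcup_(X in C) X) = \bigcup_(X in C) Bof X by [].
    apply: (@basis_mod_chain _ _ C _ _ (fun X => level (Hof X))).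
    + move=> X Y CX CY.
      have [XY|YX] := Ctot X Y CX CY; [left|right] => b; first exact: XY.
      exact: YX.
    + by move=> X CX; have [] := CP X CX.
    + by move=> X CX; apply: levelW => x Xx; exists X.
    + apply: level_directed => // X Y CX CY.
      have [Z CZ [XZ YZ]] := dirC X Y CX CY; exists Z => //.
      by split; apply: incH.
have [HT|nHT] := pselect (Hof X = setT); first by exists (Bof X); rewrite -HT.
have [x nHx] : exists x, ~ Hof X x.
  apply: contrapT => noX; apply: nHT; apply/seteqP; split=> // x _.
  by apply: contrapT => nx; apply: noX; exists x.
have [B basB] := basis_division_closure char0 gH pH nHx.
pose Y : set (G + fieldUnits K) := fun w => match w with
  | inl y => division_closure (Hof X) x y | inr b => (Bof X `|` B) b end.
have HY : Hof Y = division_closure (Hof X) x.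
  apply/seteqP; split=> y; last by right.
  by case=> [->|//]; apply: (division_closure_subgroup _ gH).1.
case: (maxX Y).
  split; last first.
    by move=> YX; apply: nHx; right; apply: YX; apply: division_closure_id.
  by case=> [y Xy|b Xb]; [apply: division_closureW => //; right|left].
split; rewrite HY.
- exact: division_closure_subgroup.
- exact: division_closure_pure.
- have -> : Bof Y = Bof X `|` B by [].
  apply: basis_mod_trans bas basB; try exact: level_subgroup.
    by apply: levelW => y ->; apply: gH.1.
  by apply: levelW; apply: division_closureW.
Qed.

End GroupAlgebra.

(** * The monomial defect group *)

Lemma free_abelian_quotient (V : zmodType) (N : zmodClosed V) (B : set V) :
  basis_mod [set u | u \in N] setT B -> free_abelian (Quotient.quot N).
Proof.
move=> [_ indB genB].
pose I : choiceType := {b : V | `[< B b >]}.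
pose pi (u : V) : Quotient.quot N := \pi_(Quotient.quot N)%qT u.
have piB : {morph pi : u v / u - v} by move=> u v; rewrite /pi !piE.
have pi0 : pi 0 = 0 by rewrite -(subrr 0) piB subrr.
have piN : {morph pi : u / - u} by move=> u; rewrite -sub0r piB pi0 sub0r.
have piD : {morph pi : u v / u + v}.
  by move=> u v; rewrite -[v in LHS]opprK piB piN opprK.
have piMz u (n : int) : pi (u *~ n) = pi u *~ n.
  have piMn m : pi (u *+ m) = pi u *+ m.
    by elim: m => [|m IHm]; rewrite ?mulr0n ?pi0 // !mulrS piD IHm.
  by case: n => n; rewrite ?NegzE ?mulrNz ?piN -!pmulrn piMn.
have piP u : pi u = 0 <-> u \in N.
  have := Quotient.idealrBE N u 0; rewrite subr0 => ->; rewrite -pi0.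
  by split=> [/eqP|/eqP].
pose f (c : {malg int[I]}) : Quotient.quot N :=
  \sum_(i <- msupp c) pi (val i) *~ mcoeff i c.
have fw (A : {fset I}) c : (msupp c `<=` A)%fset ->
    f c = \sum_(i <- A) pi (val i) *~ mcoeff i c.
  move=> cA; apply: big_fset_incl cA _ => i _ /mcoeff_outdom ->.
  by rewrite mulr0z.
have fB : zmod_morphism f.
  move=> c d; rewrite (fw _ _ (msuppB_le c d)).
  rewrite (fw _ c (fsubsetUl _ (msupp d))) (fw _ d (fsubsetUr (msupp c) _)).
  by rewrite -sumrB; apply: eq_bigr => i _; rewrite mcoeffB mulrzBr.
pose fA : {additive {malg int[I]} -> Quotient.quot N} :=
  HB.pack f (GRing.isZmodMorphism.Build _ _ f fB).
exists I, fA.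
have f_inj c : f c = 0 -> c = 0.
  move=> fc0; apply/malgP => i; rewrite mcoeff0.
  have [ic|/mcoeff_outdom //] := boolP (i \in msupp c).
  pose cV b : int := if insub b is Some j then mcoeff (j : I) c else 0.
  have cVE j : cV (val j) = mcoeff j c by rewrite /cV valK.
  rewrite -cVE; apply: (indB (map val (msupp c)) cV).
  - by rewrite (map_inj_uniq val_inj) fset_uniq.
  - by move=> _ /mapP[j _ ->]; apply/asboolP/(valP j).
  - apply/piP; rewrite -[RHS]fc0 big_map /f (big_morph pi piD pi0).
    by apply: eq_bigr => j _; rewrite piMz cVE.
  - exact: map_f.
have f_surj y : exists c, f c = y.
  rewrite -[y]reprK; move: (repr y) => u.
  apply: (genB [set u | exists c, f c = pi u]) => //.
  - split=> [|v w [c cv] [d dw]].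
      by exists 0; rewrite pi0 /f msupp0 big_seq_fset0.
    by exists (c - d); rewrite fB cv dw piB.
  - by move=> v /piP v0; exists 0; rewrite v0 /f msupp0 big_seq_fset0.
  - move=> b Bb; have Bb' : `[< B b >] by apply/asboolP.
    pose i : I := Sub b Bb'; exists (mkmalgU i 1).
    rewrite (fw [fset i]%fset _ msuppU_le) big_seq_fset1 mcoeffUU.
    by rewrite mulr1z SubK.
have [g fg] := choice f_surj.
exists g => [c|y]; last exact: fg.
apply/eqP; rewrite -subr_eq0; apply/eqP/f_inj; rewrite fB fg.
by rewrite subrr.
Qed.

Lemma fraction_ratio (R : idomainType) (z : {fraction R}) :
  exists p q : R, q != 0 /\ z = tofrac p / tofrac q.
Proof.
elim/quotW: z => r; exists \n_r, \d_r; split; first exact: denom_ratioP.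
apply: (canRL (mulfK _)); first by rewrite tofrac_eq0 denom_ratioP.
unlock tofrac; rewrite -[LHS]FracField.pi_mul; apply/eqP.
rewrite piE /= FracField.equivfE /FracField.mulf.
by rewrite !numden_Ratio ?oner_eq0 ?mulr1 ?denom_ratioP // mulrC.
Qed.

(** The canonical embedding, retyped so that its codomain carries the field
    structure of [groupFrac]. *)
Definition to_groupFrac (k : fieldType) (G : torsionFreeZmodType) :
  {rmorphism groupAlg k G -> groupFrac k G} := @tofrac (groupAlg k G).

Theorem theorem4p5 (k : fieldType) (G : torsionFreeZmodType)
  (char0 : [pchar k]%R =i pred0) : free_abelian (monomial_defect k G).
Proof.
have inj : injective (@to_groupFrac k G).
  by move=> p q /eqP; rewrite tofrac_eq => /eqP.
have [B basB] := basis_level inj char0.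
rewrite level0 // levelT in basB; last by move=> z; apply: fraction_ratio.
apply: (@free_abelian_quotient _ _ B).
suff <- : [set u | exists (c : k) g,
    c != 0 /\ fuval u = to_groupFrac k G (c *: gmon k g)] =
  [set` monomial_units k G] by [].
apply/seteqP; split=> u /=.
  by move=> [c [g [c0 ug]]]; apply/asboolP; exists c, g.
by case/asboolP=> c [g [c0 ug]]; exists c, g.
Qed.
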